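(* Let $h\in\mathbb{W}_M\cap AC([0,M];\mathbb{R}^d)$ be such that $\int_0^{S_T}|h'(t)|^2\,\mathrm{d}t<\infty$ almost surely (e.g. $h\in\mathbb{H}_M^{(1)}$). Then for any $F,G\in\mathscr{F}C_b^\infty$, $$\mathbb{E}[G\,D_hF]=\mathbb{E}[F\,D_h^*G],\qquad\text{where}\qquad D_h^*G:=-D_hG+G\int_0^{S_T}h'(t)\,\mathrm{d}W_t.$$
   Context: Conventions: for $A\in(0,\infty]$, $[0,A]$ denotes the usual closed interval if $A<\infty$ and $[0,\infty)$ if $A=\infty$; $\int_u^v$ means $\int_{(u,v)}$; $0^0:=1$. Let $0<T\le\infty$ and let $S=(S_t)_{t\in[0,T]}$ be a non-trivial subordinator, i.e. an increasing L\'evy process with $S_0=0$ and $\mathbb{E}\,e^{-uS_t}=e^{-t\phi(u)}$, $u>0$, where $\phi(u)=bu+\int_0^\infty(1-e^{-ux})\,\nu(\mathrm{d}x)$ with $b\ge0$ and $\nu$ a measure on $(0,\infty)$ with $\int_0^\infty(x\wedge1)\,\nu(\mathrm{d}x)<\infty$. If $T=\infty$, put $S_\infty:=\lim_{t\uparrow\infty}S_t$ ($=\infty$ a.s.). Let $M=\operatorname{ess\,sup}S_T\in(0,\infty]$. Let $(W_t)_{t\in[0,M]}$ be a standard $d$-dimensional Brownian motion started at $0$, independent of $S$. $\mathbb{W}_M$ is the space of continuous $w:[0,M]\to\mathbb{R}^d$ with $w(0)=0$. $AC([0,M];\mathbb{R}^d)$ is the set of absolutely continuous functions $[0,M]\to\mathbb{R}^d$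 (if $M=\infty$: absolutely continuous on every compact subinterval). For $\kappa\in\mathbb{R}$, $\mathbb{H}_M^{(\kappa)}=\{h\in\mathbb{W}_M\cap AC([0,M];\mathbb{R}^d):\int_0^M|h'(t)|^2[\mathbb{P}(S_T\ge t)]^\kappa\,\mathrm{d}t<\infty\}$. Let $\mu$ be the law of $W$ on $\mathbb{W}_M$ and $\lambda$ the law of $S$ on $\mathbb{S}_T=\{\ell:[0,T]\to[0,\infty):\ell_0=0,\ \ell\text{ increasing, c\`adl\`ag}\}$. $W$ and $S$ are realised canonically on $(\mathbb{W}_M\times\mathbb{S}_T,\mu\times\lambda)$, with $W_{S_t}(w,\ell)=w(\ell_t)$, and $\mathbb{E}$ is expectation under $\mu\times\lambda$. Let $\Omega=\{w\circ\ell:w\in\mathbb{W}_M,\ \ell\in\mathbb{S}_T\}$. $\mathscr{F}C_b^\infty$ is the set of functions $F(w\circ\ell)=f(w(\ell_{t_1}),\dots,w(\ell_{t_n}))$ on $\Omega$ with $n\in\mathbb{N}$, $f\in C_b^\infty(\mathbb{R}^{d\cdot n})$ and $t_1<\dots<t_n$ in $[0,T]$. The directional derivative is $D_hF(w\circ\ell)=\lim_{\epsilon\to0}\epsilon^{-1}[F(w\circ\ell+\epsilon h\circ\ell)-F(w\circ\ell)]$; for such $F$, $D_hF(w\circ\ell)=\sum_{i=1}^n\langle\nabla_if(w(\ell_{t_1}),\dots,w(\ell_{t_n})),h(\ell_{t_i})\rangle_{\mathbb{R}^d}$, where $\nabla_i f$ is the gradient in the $i$th variable. It is regarded as a function of 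$(w,\ell)$.
   Formalization: The identity E[G D_hF] = E[F D_h^*G] is proved whenever both expectations exist in [-∞,∞] (they can fail to exist even for h in H_M^(1)); in all cases the identity is proved conditionally on almost every path of S. *)

(* Defs.v *)
From HB Require Import structures.
From mathcomp Require Import all_boot all_order all_algebra.
From mathcomp Require Import all_classical all_reals all_analysis.
From mathcomp Require Import ess_sup_inf.

Set Implicit Arguments.
Unset Strict Implicit.
Unset Printing Implicit Defensive.

Import Order.TTheory GRing.Theory Num.Theory.
Import numFieldNormedType.Exports.

Local Open Scope classical_set_scope.
Local Open Scope ring_scope.
Local Open Scope ereal_scope.

(* [0, A] if A is finite, [0, oo) if A = +oo. *)
Definition time_set (R : realType) (A : \bar R) : set R :=
  [set t | (0 <= t)%R /\ t%:E <= A].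

(* The interval (0, A), for an extended real A. *)
Definition open_time_set (R : realType) (A : \bar R) : set R :=
  [set t | (0 < t)%R /\ t%:E < A].

Definition dotv (R : realType) (d : nat) (x y : 'rV[R]_d) : R :=
  (\sum_(i < d) x ord0 i * y ord0 i)%R.

(* The norm `|x| of MathComp-Analysis on 'rV[R]_d is the sup norm, hence this
   definition of the squared Euclidean norm. *)
Definition sqnormv (R : realType) (d : nat) (x : 'rV[R]_d) : R := dotv x x.

Definition normv (R : realType) (d : nat) (x : 'rV[R]_d) : R :=
  Num.sqrt (sqnormv x).

(* Path spaces.  A path on [0, A] is represented by its unique extension to R
   that is constant on ]-oo, 0] and, if A is finite, on [A, +oo[. *)

Record wpath (R : realType) (d : nat) (M : \bar R) := WPath {
  wval :> R -> 'rV[R]_d ;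
  wval_continuous : continuous wval ;
  wval_start : forall t : R, (t <= 0)%R -> wval t = 0%R ;
  wval_stop : forall t : R, M <= t%:E -> wval t = wval (fine M) }.

Arguments wpath : clear implicits.

Record spath (R : realType) (T : \bar R) := SPath {
  lval :> R -> R ;
  lval_nondecreasing : {homo lval : s t / (s <= t)%R} ;
  lval_right_continuous : forall t : R, lval x @[x --> t^'+] --> lval t ;
  lval_left_limit : forall t : R, cvg (lval x @[x --> t^'-]) ;
  lval_start : forall t : R, (t <= 0)%R -> lval t = 0%R ;
  lval_stop : forall t : R, T <= t%:E -> lval t = lval (fine T) }.

Definition wpath0 (R : realType) (d : nat) (M : \bar R) : wpath R d M :=
  @WPath R d M (fun=> 0%R) (fun x => cvg_cst _) (fun _ _ => erefl)
    (fun _ _ => erefl).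

Definition spath0 (R : realType) (T : \bar R) : spath T :=
  @SPath R T (fun=> 0%R) (fun _ _ _ => lexx _) (fun t => cvg_cst _)
    (fun t => is_cvg_cst _) (fun _ _ => erefl) (fun _ _ => erefl).

HB.instance Definition _ (R : realType) (d : nat) (M : \bar R) :=
  gen_eqMixin (wpath R d M).
HB.instance Definition _ (R : realType) (d : nat) (M : \bar R) :=
  gen_choiceMixin (wpath R d M).
HB.instance Definition _ (R : realType) (d : nat) (M : \bar R) :=
  isPointed.Build (wpath R d M) (@wpath0 R d M).

HB.instance Definition _ (R : realType) (T : \bar R) := gen_eqMixin (spath T).
HB.instance Definition _ (R : realType) (T : \bar R) :=
  gen_choiceMixin (spath T).
HB.instance Definition _ (R : realType) (T : \bar R) :=
  isPointed.Build (spath T) (spath0 T).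

Definition wcylinders (R : realType) (d : nat) (M : \bar R) :
    set (set (wpath R d M)) :=
  [set A | exists (t : R) (i : 'I_d) (B : set R),
    measurable B /\ A = [set w : wpath R d M | B (w t ord0 i)]].

Definition scylinders (R : realType) (T : \bar R) : set (set (spath T)) :=
  [set A | exists (t : R) (B : set R),
    measurable B /\ A = [set l : spath T | B (l t)]].

(* W_M and S_T with the sigma-algebras generated by the evaluations. *)
Notation wspace R d M := (g_sigma_algebraType (@wcylinders R d M)).
Notation sspace T := (g_sigma_algebraType (@scylinders _ T)).

(* S_T; for T = +oo this is the limit of S_t at infinity. *)
Definition terminal (R : realType) (T : \bar R) (l : spath T) : \bar R :=
  if T is r%:E then (l r)%:E else lim ((l t)%:E @[t --> +oo%R]).

Definition mutually_independent (disp : measure_display)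
    (O : measurableType disp) (R : realType) (P : probability O R)
    (I : finType) (X : I -> O -> R) : Prop :=
  forall B : I -> set R, (forall i, measurable (B i)) ->
    P [set o | forall i, B i (X i o)] = \prod_i P [set o | B i (X i o)].

Definition increasing_times (R : realType) (A : \bar R) (n : nat)
    (t : nat -> R) : Prop :=
  (forall k, (k <= n)%N -> time_set A (t k)) /\
  (forall k, (k < n)%N -> (t k <= t k.+1)%R).

(* mu is the law of a standard d-dimensional Brownian motion on [0, M]:
   continuity and W_0 = 0 are built into wpath. *)
Definition brownian_law (R : realType) (d : nat) (M : \bar R)
    (mu : probability (wspace R d M) R) : Prop :=
  (forall (n : nat) (t : nat -> R), increasing_times M n t ->
     mutually_independent mu
       (fun (ki : 'I_n * 'I_d) (w : wspace R d M) =>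
          (w (t ki.1.+1) ord0 ki.2 - w (t ki.1) ord0 ki.2)%R)) /\
  (forall s t : R, time_set M s -> time_set M t -> (s < t)%R ->
     forall (i : 'I_d) (B : set R), measurable B ->
       mu [set w : wspace R d M |
            B ((w : wpath R d M) t ord0 i - (w : wpath R d M) s ord0 i)%R] =
       normal_prob 0%R (Num.sqrt (t - s)%R) B).

Definition laplace_exponent (R : realType) (b : R)
    (nu : {measure set (measurableTypeR R) -> \bar R}) (u : R) : R :=
  (b * u + \int[nu]_(x in `]0%R, +oo[) (1 - expR (- (u * x))))%R.

(* lambda is the law of a subordinator on [0, T] with drift b and Levy measure
   the restriction of nu to (0, oo). *)
Definition subordinator_law (R : realType) (T : \bar R)
    (lambda : probability (sspace T) R) (b : R)
    (nu : {measure set (measurableTypeR R) -> \bar R}) : Prop :=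
  [/\ (forall (n : nat) (t : nat -> R), increasing_times T n t ->
        mutually_independent lambda
          (fun (k : 'I_n) (l : sspace T) => (l (t k.+1) - l (t k))%R)),
      (forall s t : R, time_set T s -> time_set T t -> (s <= t)%R ->
        forall B : set R, measurable B ->
          lambda [set l : sspace T | B ((l : spath T) t - (l : spath T) s)%R] =
          lambda [set l : sspace T | B ((l : spath T) (t - s)%R)]),
      (0 <= b)%R,
      \int[nu]_(x in `]0%R, +oo[) (Num.min x 1%R)%:E < +oo &
      forall u t : R, (0 < u)%R -> time_set T t ->
        'E_lambda[fun l : sspace T => expR (- (u * l t))%R] =
        (expR (- (t * laplace_exponent b nu u)))%:E].

Definition nontrivial_law (R : realType) (T : \bar R)
    (lambda : probability (sspace T) R) : Prop :=
  ~ (\forall l \ae lambda, forall t : R, (l : spath T) t = 0%R).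

Definition abs_continuous (R : realType) (d : nat) (M : \bar R)
    (h : R -> 'rV[R]_d) : Prop :=
  forall a : R, time_set M a -> forall e : R, (0 < e)%R ->
  exists2 delta : R, (0 < delta)%R &
    forall (n : nat) (u v : nat -> R),
      (forall k, (k < n)%N -> [/\ 0 <= u k, u k <= v k & v k <= a])%R ->
      (forall k, (k.+1 < n)%N -> (v k <= u k.+1)%R) ->
      (\sum_(k < n) (v k - u k) < delta)%R ->
      (\sum_(k < n) normv (h (v k) - h (u k)) < e)%R.

Definition in_H (R : realType) (d : nat) (T M : \bar R)
    (lambda : probability (sspace T) R) (kappa : R) (h : wpath R d M) : Prop :=
  abs_continuous M h /\
  \int[lebesgue_measure]_(t in open_time_set M)
    (sqnormv (derive1 h t) *
     ((fine (lambda [set l | (t%:E <= terminal l)%E])) `^ kappa))%:E < +oo.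

(* Differentiation coordinatewise in R^(n d), seen as the space of the n-tuples
   of points of R^d. *)
Fixpoint Cb (R : realType) (n d k : nat) (f : 'M[R]_(n, d) -> R) : Prop :=
  [/\ continuous f,
      (exists C : R, forall x, (`|f x| <= C)%R) &
      if k is k'.+1 then
        forall (i : 'I_n) (j : 'I_d),
          (forall x, derivable f x (delta_mx i j)) /\
          Cb k' ('D_(delta_mx i j) f)
      else True].

Definition Cb_infty (R : realType) (n d : nat) (f : 'M[R]_(n, d) -> R) : Prop :=
  forall k : nat, Cb k f.

Definition Omega (R : realType) (d : nat) (T M : \bar R) :
    set (R -> 'rV[R]_d) :=
  [set o | exists (w : wpath R d M) (l : spath T), o = w \o l].

(* Only the restriction of F to Omega is meaningful. *)
Definition FCb_infty (R : realType) (d : nat) (T M : \bar R)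
    (F : (R -> 'rV[R]_d) -> R) : Prop :=
  exists (n : nat) (f : 'M[R]_(n, d) -> R) (t : 'I_n -> R),
    [/\ Cb_infty f,
        (forall i, time_set T (t i)),
        (forall i j : 'I_n, (i < j)%N -> (t i < t j)%R) &
        forall o, Omega T M o ->
          F o = f (\matrix_(i < n, j < d) o (t i) ord0 j)].

Definition on_paths (R : realType) (d : nat) (T M : \bar R)
    (F : (R -> 'rV[R]_d) -> R) (z : wspace R d M * sspace T) : R :=
  F ((z.1 : wpath R d M) \o (z.2 : spath T)).

(* D_h F as a function of (w, l); w + eps h is again a path in W_M, so that
   F is evaluated on Omega only. *)
Definition Dh (R : realType) (d : nat) (T M : \bar R) (h : wpath R d M)
    (F : (R -> 'rV[R]_d) -> R) (z : wspace R d M * sspace T) : R :=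
  let w : wpath R d M := z.1 in
  let l : spath T := z.2 in
  lim ((eps^-1 * (F (fun t => w (l t) + eps *: h (l t)) - F (w \o l)))%R
         @[eps --> (0%R : R)^']).

(* The step function sum_(k < n) c_k 1_(t_k, t_(k+1)] and its elementary
   stochastic integral. *)
Record step (R : realType) (d : nat) := Step {
  step_size : nat ;
  step_time : nat -> R ;
  step_coef : nat -> 'rV[R]_d }.

Definition step_fun (R : realType) (d : nat) (p : step R d) (x : R) :
    'rV[R]_d :=
  (\sum_(k < step_size p)
     \1_`](step_time p k), (step_time p k.+1)] x *: step_coef p k)%R.

Definition step_integral (R : realType) (d : nat) (p : step R d)
    (w : R -> 'rV[R]_d) : R :=
  (\sum_(k < step_size p)
     dotv (step_coef p k) (w (step_time p k.+1) - w (step_time p k)))%R.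

(* X is a version of the Wiener-Ito integral of the deterministic function g
   against dW over (0, a): the L^2(mu)-limit of the elementary integrals of
   step functions on [0, a] that converge to g in L^2(0, a). *)
Definition is_wiener_integral (R : realType) (d : nat) (M : \bar R)
    (mu : probability (wspace R d M) R) (a : \bar R) (g : R -> 'rV[R]_d)
    (X : wspace R d M -> R) : Prop :=
  measurable_fun setT X /\
  exists p : nat -> step R d,
    [/\ (forall m, increasing_times a (step_size (p m)) (step_time (p m))),
        (\int[lebesgue_measure]_(x in open_time_set a)
           (sqnormv (step_fun (p m) x - g x)%R)%:E) @[m --> \oo] --> 0 &
        (\int[mu]_w ((step_integral (p m) (w : wpath R d M) - X w) ^+ 2)%:E)
           @[m --> \oo] --> 0].

(* J is a version of int_0^(S_T) h' dW: as W and S are independent, this is,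
   for almost every path l of S, the Wiener integral of h' over (0, l_T). Two
   versions agree almost surely for mu \x lambda. *)
Definition is_stochastic_integral (R : realType) (d : nat) (T M : \bar R)
    (mu : probability (wspace R d M) R) (lambda : probability (sspace T) R)
    (h : wpath R d M) (J : wspace R d M * sspace T -> R) : Prop :=
  measurable_fun setT J /\
  \forall l \ae lambda,
    is_wiener_integral mu (terminal l) (derive1 h) (fun w => J (w, l)).

Definition Dh_adj (R : realType) (d : nat) (T M : \bar R) (h : wpath R d M)
    (J : wspace R d M * sspace T -> R) (G : (R -> 'rV[R]_d) -> R)
    (z : wspace R d M * sspace T) : R :=
  (- Dh h G z + on_paths G z * J z)%R.

(* The expectation of X exists in [-oo, +oo]; otherwise 'E_P[X] is a
   conventional value (oo - oo = -oo) without meaning. *)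
Definition has_expectation (disp : measure_display) (O : measurableType disp)
    (R : realType) (P : probability O R) (X : O -> R) : Prop :=
  \int[P]_o (Num.max (X o) 0)%R%:E < +oo \/
  \int[P]_o (Num.max (- X o) 0)%R%:E < +oo.

(* Main.v *)
Require Import Defs.
From HB Require Import structures.
From mathcomp Require Import all_boot all_order all_algebra.
From mathcomp Require Import all_classical all_reals all_analysis.
From mathcomp Require Import ess_sup_inf measurable_realfun.
From mathcomp Require Import ring lra.

(** Conditionally on the path l of S, the statement is the Cameron-Martin
  integration by parts for Brownian motion on [0, l_T], along h.  Since
  f(W_s) g(W_r) is a functional of the increments of W over a grid containing
  all the times involved, Gaussian integration by parts in one coordinate of one
  increment, the others being independent of it, gives E[Phi Y] = E[D_V Phi] for
  Y that increment and V the path t |-> Cov(Y, W_t).  By linearity the identity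
  holds for every elementary integral Y = int p dW of a step function p, with V
  the primitive of p.  If p_m -> h' in L^2(0, l_T), then Y_m -> int h' dW in
  L^1, while V_m -> h at each of the finitely many times involved, because the
  absolutely continuous path h is the primitive of h'; so the identity passes to
  the limit.  The product rule for D_h turns it into the claim for fixed l, and
  Tonelli's theorem, applied to positive and negative parts, integrates over l. *)

Set Implicit Arguments.
Unset Strict Implicit.
Unset Printing Implicit Defensive.

Import Order.TTheory GRing.Theory Num.Theory.
Import numFieldNormedType.Exports.
Local Open Scope classical_set_scope.
Local Open Scope ring_scope.
Local Open Scope ereal_scope.

(** * Absolutely continuous functions are primitives *)

Section AbsoluteContinuity.
Context {R : realType}.
Local Open Scope ring_scope.
Implicit Types (a : R) (h g : R -> R) (L : seq (R * R)).

(** [X] and [Y] are not assumed integrable for the product measure: they involve [h] at the random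
    times l_t, where [h] may be unbounded. Hence the identity is first proved for fixed [l], where
    everything is integrable, and the averaging has to cope with integrals of which only the
    positive or only the negative part is finite. Freezing [l] requires no conditional expectation,
    since the measure is a product. The other obstacle is [derive1 h]. It is arbitrary where [h] is
    not derivable, so an integral containing it is only a lower integral. Estimates are made on a
    measurable function that agrees with it almost everywhere. That [h] is the primitive of this
    function comes from the Jordan decomposition, the Radon-Nikodym theorem for Stieltjes measures
    and Lebesgue differentiation. Both L^2 convergences enter only through |y| <= delta + y^2 /
    delta with delta free, which takes the place of the Cauchy-Schwarz inequality. *)

Definition endpoints L : seq R := flatten [seq [:: p.1; p.2] | p <- L].

(* [L] lists intervals; the two conditions on [endpoints L] say that they are
   non-overlapping, listed from left to right, and contained in [0, a]. *)
Definition ac_on a h := forall e : R, 0 < e -> exists2 delta : R, 0 < delta &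
  forall L, path <=%R 0 (endpoints L) -> last 0 (endpoints L) <= a ->
    \sum_(p <- L) (p.2 - p.1) < delta -> \sum_(p <- L) `|h p.2 - h p.1| <= e.

Lemma endpoints_cat L1 L2 : endpoints (L1 ++ L2) = endpoints L1 ++ endpoints L2.
Proof. by rewrite /endpoints map_cat flatten_cat. Qed.

Lemma endpoints_cons p L : endpoints (p :: L) = [:: p.1, p.2 & endpoints L].
Proof. by []. Qed.

Lemma ac_onB a h g : ac_on a h -> ac_on a g -> ac_on a (h \- g).
Proof.
move=> hac gac e e0.
have e20 : 0 < e / 2 by rewrite divr_gt0.
have [d1 d10 H1] := hac _ e20; have [d2 d20 H2] := gac _ e20.
exists (Num.min d1 d2); first by rewrite lt_min d10.
move=> L pL lL; rewrite lt_min => /andP[/H1 s1 /H2 s2].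
have {s1 s2} := lerD (s1 pL lL) (s2 pL lL); rewrite -splitr => /(le_trans _); apply.
rewrite -big_split/= ler_sum// => p _.
rewrite opprB addrACA -opprB opprK.
by rewrite [leLHS](_ : _ = `|h p.2 - h p.1 - (g p.2 - g p.1)|) ?ler_normB//; congr `|_|; ring.
Qed.

Lemma path_le_endpoints (z x : R) (s : seq R) : z <= x ->
  path <%R x s -> path <=%R z (endpoints (zip (x :: s) s)).
Proof.
elim: s z x => //= y s ih z x zx /andP[xy ys].
by rewrite zx (ltW xy)/=; exact: ih.
Qed.

Lemma last_endpoints (z x y : R) (s : seq R) :
  last z (endpoints (zip (x :: y :: s) (y :: s))) = last y s.
Proof. by elim: s z x y => //= t s ih z x y; exact: ih. Qed.

Lemma sum_endpoints (x : R) (s : seq R) (f : R -> R) :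
  \sum_(p <- zip (x :: s) s) (f p.2 - f p.1) = f (last x s) - f x.
Proof.
elim: s x => [|y s ih] x /=; first by rewrite big_nil subrr.
by rewrite big_cons ih/=; ring.
Qed.

Notation TV := (@total_variation R).

(* The intervals of [L1] are refined into partitions one after the other, the
   last one first; [L2] is the part of the list that is already refined. *)
Lemma ac_on_TV_list a h e delta :
  (forall L, path <=%R 0 (endpoints L) -> last 0 (endpoints L) <= a ->
    \sum_(p <- L) (p.2 - p.1) < delta -> \sum_(p <- L) `|h p.2 - h p.1| <= e) ->
  forall L1 L2, path <=%R 0 (endpoints (L1 ++ L2)) ->
    last 0 (endpoints (L1 ++ L2)) <= a ->
    \sum_(p <- L1 ++ L2) (p.2 - p.1) < delta ->
    (\sum_(p <- L1) TV p.1 p.2 h + (\sum_(p <- L2) `|h p.2 - h p.1|)%:E <= e%:E)%E.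
Proof.
move=> H; elim/last_ind => [|L1 p ih] L2.
  by move=> pL lL sL; rewrite big_nil add0e lee_fin; exact: H.
rewrite cat_rcons => pL lL sL.
have p12 : p.1 <= p.2.
  by move: pL; rewrite endpoints_cat endpoints_cons cat_path/= => /andP[_ /and3P[]].
rewrite -cats1 big_cat big_seq1/=.
(* The intervals of a partition of [p] have the same total length as [p], so moving them to the
   refined part leaves the hypotheses on the whole list intact, with the same [delta]. *)
have key (s : seq R) : itv_partition p.1 p.2 s ->
    (\sum_(q <- L1) TV q.1 q.2 h + (variation p.1 p.2 h s)%:E +
      (\sum_(q <- L2) `|h q.2 - h q.1|)%:E <= e%:E)%E.
  move=> ps; rewrite variation_zip//.
  have -> : \sum_(x <- zip s (p.1 :: s)) `|h x.1 - h x.2| =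
            \sum_(x <- zip (p.1 :: s) s) `|h x.2 - h x.1|.
    elim: s (p.1) {ps} => [|y s IH] x /=; first by rewrite !big_nil.
    by rewrite !big_cons/= IH.
  rewrite -addeA -EFinD -big_cat/=.
  case: ps => ps /eqP ls.
  apply: ih.
  - move: pL; rewrite !endpoints_cat endpoints_cons !cat_path.
    move=> /andP[-> /andP[l1 /andP[_ p2]]].
    case: s ps ls => [/= _ p12E|y s ps ls].
      by rewrite (path_le le_trans _ p2)// (le_trans l1).
    by rewrite last_endpoints -[last y s]/(last p.1 (y :: s)) ls path_le_endpoints.
  - move: lL pL; rewrite !endpoints_cat endpoints_cons !last_cat cat_path/= => lL.
    case: s ps ls => [/= _ p12E|y s ps ls]; last by rewrite last_endpoints -[last y s]/(last p.1 (y :: s)) ls.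
    case: (endpoints L2) lL => //= p2a /andP[_ /andP[l1 _]].
    by rewrite (le_trans l1)// (le_trans p12).
  - move: sL; rewrite !big_cat/= big_cons; apply: le_lt_trans.
    by rewrite (sum_endpoints p.1 s (fun x => x)) ls.
have [s0 ps0] : exists s, itv_partition p.1 p.2 s.
  move: p12; rewrite le_eqVlt => /predU1P[->|p12]; first by exists [::].
  by exists [:: p.2]; exact: itv_partition1.
(* Passing to the supremum over partitions requires moving the other terms to the right-hand side,
   so they have to be real: [+oo] contradicts [key] at [s0], and [-oo] makes the claim trivial. *)
move: (\sum_(q <- L1) _)%E key => [r||] key; last 2 first.
- by have := key _ ps0.
- by rewrite !addNye leNye.
set c := (X in (_ + X%:E)%E).
suff : (TV p.1 p.2 h <= (e - c - r)%:E)%E.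
  case: (TV _ _ _) => [t||] //=; last by move=> _; exact: leNye.
  by rewrite -!EFinD !lee_fin; lra.
apply: ge_ereal_sup => _ [_ [s ps <-] <-].
by have := key _ ps; rewrite -?EFinD !lee_fin -/c; lra.
Qed.

End AbsoluteContinuity.

(** * Bounded variation and absolute continuity of the variation *)

Section AcVariation.
Context {R : realType}.
Local Open Scope ring_scope.
Implicit Types (a : R) (h g : R -> R) (L : seq (R * R)).
Notation TV := (@total_variation R).

Lemma ac_on_TV a h : ac_on a h -> forall e, 0 < e -> exists2 delta, 0 < delta &
  forall L, path <=%R 0 (endpoints L) -> last 0 (endpoints L) <= a ->
    \sum_(p <- L) (p.2 - p.1) < delta ->
    (\sum_(p <- L) TV p.1 p.2 h <= e%:E)%E.
Proof.
move=> hac e e0; have [delta d0 H] := hac e e0; exists delta => // L pL lL sL.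
have := @ac_on_TV_list _ _ _ _ _ H L [::].
by rewrite cats0 big_nil adde0; exact.
Qed.

(** The modulus for e = 1 bounds the variation by 1 on every interval shorter than [delta], and
    finitely many steps of length [delta / 2] reach [a]. *)
Lemma ac_on_bounded_variation a h : 0 <= a -> ac_on a h -> bounded_variation 0 a h.
Proof.
move=> a0 hac; have [delta d0 H] := ac_on_TV hac ltr01.
have step s t : 0 <= s -> s <= t -> t <= a -> t - s < delta -> TV s t h \is a fin_num.
  move=> s0 st ta std; rewrite ge0_fin_numE ?total_variation_ge0//.
  have := H [:: (s, t)]; rewrite !big_seq1 /= s0 st => /(_ isT ta std) /le_lt_trans.
  by apply; rewrite ltry.
apply/bounded_variationP => //.
have main n : forall t, 0 <= t -> t <= a -> t <= n%:R * (delta / 2) -> TV 0 t h \is a fin_num.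
  elim: n => [|n ih] t t0 ta.
    rewrite mul0r => t0'; rewrite (_ : t = 0) ?total_variationxx//.
    by apply/eqP; rewrite eq_le t0' t0.
  move=> tn; set s := Num.min t (n%:R * (delta / 2)).
  have s0 : 0 <= s by rewrite le_min t0 mulr_ge0// divr_ge0// ltW.
  have st : s <= t by rewrite ge_min lexx.
  rewrite (total_variationD h s0 st) fin_numD ih//=; last 2 first.
  - exact: le_trans st ta.
  - by rewrite ge_min lexx orbT.
  apply: step => //; rewrite /s; case: (leP t); rewrite ?subrr//.
  by move=> _; move: tn; rewrite -[n.+1%:R]natr1; lra.
have := archi_boundP (divr_ge0 a0 (ltW d0)); set n := Num.bound _.
rewrite ltr_pdivrMr// => an; apply: (main n.*2) => //.
by rewrite -muln2 natrM; lra.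
Qed.

Lemma TV_fin_num a h s t : bounded_variation 0 a h -> 0 <= s -> s <= t -> t <= a ->
  TV s t h \is a fin_num.
Proof.
move=> bv s0 st ta; apply/bounded_variationP => //.
exact: bounded_variationr s0 st (bounded_variationl (le_trans s0 st) ta bv).
Qed.

Lemma TV_sub a h s t : bounded_variation 0 a h -> 0 <= s -> s <= t -> t <= a ->
  fine (TV 0 t h) - fine (TV 0 s h) = fine (TV s t h).
Proof.
move=> bv s0 st ta; have sa := le_trans st ta.
rewrite (total_variationD h s0 st) fineD ?(TV_fin_num bv)//.
by rewrite addrAC subrr add0r.
Qed.

Lemma mem_endpoints a L (p : R * R) : path <=%R 0 (endpoints L) ->
  last 0 (endpoints L) <= a -> p \in L -> [/\ 0 <= p.1, p.1 <= p.2 & p.2 <= a].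
Proof.
suff main z : path <=%R z (endpoints L) -> last z (endpoints L) <= a -> p \in L ->
    [/\ z <= p.1, p.1 <= p.2 & p.2 <= a] by exact: main.
elim: L z => // q L ih z; rewrite endpoints_cons /= => /and3P[zq1 q12 pL] lL.
have lge (y : R) s : path <=%R y s -> y <= last y s.
  elim: s y => //= x s IH y /andP[yx /IH]; exact: le_trans.
rewrite inE => /predU1P[->|/(ih _ pL lL)[? ? ?]].
  by split => //; rewrite (le_trans _ lL)//; exact: lge.
by split => //; rewrite (le_trans zq1)// (le_trans q12).
Qed.

Lemma ac_on_variation a h : 0 <= a -> ac_on a h -> ac_on a (fun t => fine (TV 0 t h)).
Proof.
move=> a0 hac e e0; have bv := ac_on_bounded_variation a0 hac.
have [delta d0 H] := ac_on_TV hac e0; exists delta => // L pL lL sL.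
rewrite -lee_fin; apply: le_trans (H L pL lL sL).
rewrite -sumEFin big_seq [leRHS]big_seq; apply: lee_sum => p /(mem_endpoints pL lL)[p0 p12 pa].
by rewrite (TV_sub bv)// ger0_norm ?fine_ge0 ?total_variation_ge0// fineK// (TV_fin_num bv).
Qed.

(** Discarding cells of a grid leaves gaps but no overlaps, so any selection of cells is an
    admissible list for [ac_on]. The offset [k] serves the induction. *)
Lemma endpoints_filter (x : nat -> R) (P : pred nat) (m k : nat) (z : R) :
  {homo x : i j / (i <= j)%N >-> i <= j} -> z <= x k ->
  let L := [seq (x j, x j.+1) | j <- iota k m & P j] in
  path <=%R z (endpoints L) /\ last z (endpoints L) <= x (k + m)%N.
Proof.
move=> xnd; elim: m k z => [|m ih] k z zxk /=; first by rewrite addn0.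
case: ifP => _ /=; last first.
  by rewrite addnS -addSn; apply: ih; rewrite (le_trans zxk)// xnd.
by rewrite zxk xnd//= addnS -addSn; exact: ih.
Qed.

End AcVariation.

(** * Stieltjes measures of absolutely continuous functions *)

Section AcDensity.
Context {R : realType}.
Local Open Scope ring_scope.
Implicit Types (a : R) (h g : R -> R) (L : seq (R * R)).
Notation leb := (@lebesgue_measure R).

(** Composition with [clamp a] extends a function on [0, a] by constants to the whole line, where
    Stieltjes measures are defined. *)
Definition clamp a (t : R) : R := Num.min (Num.max 0 t) a.

Lemma clamp_id a t : 0 <= t -> t <= a -> clamp a t = t.
Proof. by move=> t0 ta; rewrite /clamp max_r// min_l. Qed.

Lemma clamp_itv a t : 0 <= a -> 0 <= clamp a t /\ clamp a t <= a.
Proof. by move=> a0; rewrite /clamp ge_min lexx orbT le_min le_max lexx a0. Qed.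

Lemma clamp_homo a : {homo clamp a : s t / s <= t}.
Proof.
move=> s t st; rewrite /clamp; apply: le_min2 => //.
by apply: le_max2.
Qed.

Lemma clamp_lip a s t : 0 <= a -> s <= t -> clamp a t - clamp a s <= t - s.
Proof.
move=> a0 st; rewrite /clamp.
by case: (leP 0 s) => s0; case: (leP 0 t) => t0;
  case: (leP s a) => sa; case: (leP t a) => ta; case: (leP 0 a) => ?; lra.
Qed.

Lemma ac_cumulative a g : 0 <= a -> {in `[0, a] &, nondecreasing_fun g} -> ac_on a g ->
  exists G : cumulative R R, forall t, G t = g (clamp a t).
Proof.
move=> a0 gnd gac.
have clI t : clamp a t \in `[0, a] by rewrite in_itv/=; apply/andP/clamp_itv.
have Gnd : {homo g \o clamp a : s t / s <= t}.
  by move=> s t st; apply: gnd => //; exact: clamp_homo.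
have Grc : right_continuous (g \o clamp a).
  move=> t; apply/cvgrPdist_le => /= e e0.
  have [delta d0 H] := gac e e0.
  near=> s.
  have ts : t <= s by near: s; exact: nbhs_right_ge.
  have std : s - t < delta.
    rewrite ltrBlDr addrC; near: s; apply: nbhs_right_lt; rewrite ltrDl//.
  have := H [:: (clamp a t, clamp a s)]; rewrite !big_seq1 /= distrC; apply.
  - by rewrite (clamp_itv _ _).1// clamp_homo.
  - by rewrite (clamp_itv _ _).2.
  - by apply: le_lt_trans std; exact: clamp_lip.
by exists (HB.pack_for (cumulative R R) (g \o clamp a)
  (isCumulative.Build R _ R (g \o clamp a) Gnd Grc)).
Unshelve. all: by end_near. Qed.

Lemma LS_itvoc (G : cumulative R R) (s t : R) : s <= t ->
  lebesgue_stieltjes_measure G `]s, t] = (G t - G s)%:E.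
Proof.
move=> st; rewrite /lebesgue_stieltjes_measure /measure_extension.
by rewrite measurable_mu_extE/= ?wlength_itv_bnd//; exact: is_ocitv.
Qed.

(** Half-open cells are disjoint and carry the Stieltjes mass given by the increment over the cell;
    the rejected ones become empty, so that the index set stays an initial segment. *)
Definition cells (x : nat -> R) (U : set R) (j : nat) : set R :=
  if `[< `]x j, x j.+1]%classic `<=` U >] then `]x j, x j.+1]%classic else set0.

Lemma measure_cells (G : cumulative R R) (x : nat -> R) (U : set R) n :
  {homo x : i j / (i <= j)%N >-> i <= j} ->
  lebesgue_stieltjes_measure G (\big[setU/set0]_(j < n) cells x U j) =
  (\sum_(p <- [seq (x j, x j.+1) | j <- iota 0 n & `[< `]x j, x j.+1]%classic `<=` U >]])
     (G p.2 - G p.1))%:E.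
Proof.
move=> xnd.
have mc j : measurable (cells x U j) by rewrite /cells; case: ifP.
rewrite measure_semi_additive_ord_I//=; last 2 first.
- apply/trivIsetP => i j _ _.
  wlog ij : i j / (i < j)%N => [hw|].
    by rewrite neq_lt => /orP[ij|ij]; [|rewrite setIC]; apply: hw => //; rewrite ltn_eqF.
  move=> _; rewrite /cells; case: ifP; case: ifP => _ _; rewrite ?set0I ?setI0//.
  apply/seteqP; split => // t /= []; rewrite !in_itv/= => /andP[_ t1] /andP[t2 _].
  by have := lt_le_trans t2 t1; rewrite ltNge xnd.
- by apply: bigsetU_measurable => j _; exact: mc.
rewrite big_map big_filter -sumEFin [in RHS]big_mkcond/=.
have -> : iota 0 n = index_iota 0 n by rewrite /index_iota subn0.
rewrite big_mkord.
apply: eq_bigr => j _; rewrite /cells; case: ifP => // _.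
by rewrite LS_itvoc// xnd.
by move=> k _; exact: mc.
Qed.

(* The open set [U] is exhausted by the dyadic cells that it contains. *)
Lemma ac_LS_open a (g : R -> R) (G : cumulative R R) (e delta : R) (U : set R) : 0 < a ->
  (forall t, G t = g (clamp a t)) ->
  (forall L, path <=%R 0 (endpoints L) -> last 0 (endpoints L) <= a ->
    \sum_(p <- L) (p.2 - p.1) < delta -> \sum_(p <- L) `|g p.2 - g p.1| <= e) ->
  open U -> (leb U < delta%:E)%E ->
  (lebesgue_stieltjes_measure G (U `&` `]0%R, a]%classic) <= e%:E)%E.
Proof.
move=> a0 GE H oU Ud.
pose x n (k : nat) : R := a * k%:R / 2 ^+ n.
have p2 n : 0 < 2 ^+ n :> R by rewrite exprn_gt0.
have xnd n : {homo x n : i j / (i <= j)%N >-> i <= j}.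
  move=> i j ij; rewrite /x ler_pM2r ?invr_gt0// ler_pM2l// ler_nat//.
have xn n : x n (2 ^ n)%N = a by rewrite /x natrX mulfK// gt_eqF.
have x0 n : x n 0%N = 0 by rewrite /x mulr0 mul0r.
pose F n := \big[setU/set0]_(j < 2 ^ n) cells (x n) U j.
have mc n j : measurable (cells (x n) U j) by rewrite /cells; case: ifP.
have mF n : measurable (F n) by exact: bigsetU_measurable.
have FE n t : F n t <-> exists j, [/\ (j < 2 ^ n)%N, `]x n j, x n j.+1] `<=` U & t \in `]x n j, x n j.+1]].
  rewrite /F -(bigcup_mkord _ (cells (x n) U)); split => [[j /= jn]|[j [jn jU tj]]].
    by rewrite /cells; case: ifPn => // /asboolP jU tj; exists j; split.
  by exists j => //; rewrite /cells; case: ifPn => //= /asboolP.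
have -> : U `&` `]0, a] = \bigcup_n F n.
  apply/seteqP; split=> t.
    move=> [Ut /=]; rewrite in_itv/= => /andP[t0 ta].
    have /nbhs_ballP[r /= r0 rU] : nbhs t U by exact: open_nbhs_nbhs.
    have [n an] : exists n, a / 2 ^+ n < r.
      exists (Num.bound (a / r)); rewrite ltr_pdivrMr// mulrC -ltr_pdivrMr//.
      apply: (lt_trans (archi_boundP (divr_ge0 (ltW a0) (ltW r0)))).
      by rewrite -natrX ltr_nat ltn_expl.
    have ext : exists k, t <= x n k by exists (2 ^ n)%N; rewrite xn.
    (* The least grid point at or above [t] closes the cell of [t]; it is not the point 0, as t > 0.
       The mesh is less than [r], so this cell stays in the ball around [t] and hence in [U]. *)
    case: (ex_minnP ext) => -[|k] tk kmin; first by move: tk; rewrite x0 leNgt t0.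
    have tk' : x n k < t by rewrite ltNge; apply/negP => /kmin; rewrite ltnn.
    have xS : x n k.+1 = x n k + a / 2 ^+ n.
      by rewrite /x -natr1 mulrDr mulr1 mulrDl.
    exists n => //; apply/FE; exists k; split.
    - by apply: kmin; rewrite xn.
    - move=> s; rewrite /= in_itv/= xS => /andP[ks sk]; apply: rU.
      by rewrite /ball/= ltr_distlC; move: tk; rewrite xS; lra.
    - by rewrite in_itv/= tk'.
  move=> [n _ /FE[j [jn jU tj]]]; split; first exact: jU.
  move: tj; rewrite /= !in_itv/= => /andP[jt tj]; apply/andP; split.
    by apply: le_lt_trans jt; rewrite -(x0 n) xnd.
  by apply: (le_trans tj); rewrite -(xn n) xnd.
have Fnd : nondecreasing_seq F.
  (* The cell [j] of level [n] is the union of the cells [j.*2] and [j.*2.+1] of the next level,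
     which inherit the inclusion in [U]; the midpoint decides which of them contains [t]. *)
  apply/nondecreasing_seqP => n; apply/subsetPset => t /FE[j [jn jU]].
  rewrite in_itv/= => /andP[jt tj].
  have xx k : x n.+1 k.*2 = x n k.
    by rewrite /x exprS -muln2 natrM; field; rewrite gt_eqF.
  have mid1 : x n.+1 j.*2 <= x n.+1 j.*2.+1 by exact: xnd.
  have mid2 : x n.+1 j.*2.+1 <= x n.+1 j.*2.+2 by exact: xnd.
  have xxS : x n.+1 j.*2.+2 = x n j.+1 by rewrite -doubleS xx.
  apply/FE; have [tm|tm] := leP t (x n.+1 j.*2.+1).
    exists j.*2; split; first by rewrite expnS mul2n ltn_double.
    - apply: subset_trans jU => s /=; rewrite !in_itv/= xx => /andP[->/=].
      by move=> /le_trans; apply; rewrite -xxS.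
    - by rewrite in_itv/= xx jt.
  exists j.*2.+1; split; first by rewrite expnS mul2n -doubleS in jn *; rewrite ltn_Sdouble.
  - apply: subset_trans jU => s /=; rewrite !in_itv/= xxS => /andP[+ ->]; rewrite andbT.
    by apply: le_lt_trans; rewrite -xx.
  - by rewrite in_itv/= xxS tm.
have cvF := @nondecreasing_cvg_mu _ (measurableTypeR R) R (lebesgue_stieltjes_measure G) F mF
  (bigcupT_measurable _ mF) Fnd.
have <- := cvg_lim _ cvF => //.
apply: lime_le; first by apply/cvg_ex; eexists; exact: cvF.
apply: nearW => n /=.
rewrite (measure_cells G U (2 ^ n) (xnd n)) lee_fin.
set L := [seq _ | _ <- _ & _].
have [pL lL] := endpoints_filter (fun j => `[< `]x n j, x n j.+1]%classic `<=` U >]) (2 ^ n) (xnd n) (lexx (x n 0%N)).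
rewrite -/L x0 xn in pL lL.
have lenL : \sum_(p <- L) (p.2 - p.1) < delta.
  rewrite -lte_fin; apply: le_lt_trans Ud.
  (* Lebesgue measure is the Stieltjes measure of the identity, so the total length of the selected
     cells is the Lebesgue measure of [F n]. *)
  have <- := measure_cells idfun U (2 ^ n) (xnd n).
  apply: le_measure; rewrite ?inE.
  - exact: mF.
  - exact: measurable_realfun.open_measurable.
  - by move=> t /FE[j [_ jU /jU]].
apply: le_trans (H L pL lL lenL).
rewrite big_seq [leRHS]big_seq; apply: ler_sum => p /(mem_endpoints pL lL)[p0 p12 pa].
have p1a := le_trans p12 pa; have p20 := le_trans p0 p12.
by rewrite !GE !clamp_id// ler_norm.
Qed.

End AcDensity.

(** * Density and almost everywhere derivative *)

Section AcFTC.
Context {R : realType}.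
Local Open Scope ring_scope.
Implicit Types (a : R) (h g : R -> R) (L : seq (R * R)).
Notation leb := (@lebesgue_measure R).
Notation TV := (@total_variation R).

(** A Lebesgue null set lies in open sets of arbitrarily small length, whose Stieltjes mass inside
    ]0, a] is small by [ac_LS_open]. So the Stieltjes measure of [g], restricted to ]0, a], is
    dominated by Lebesgue measure, and [f] is its Radon-Nikodym derivative. *)
Lemma ac_nondecreasing_density a g : 0 < a ->
  {in `[0, a] &, nondecreasing_fun g} -> ac_on a g ->
  exists2 f : R -> R, leb.-integrable setT (EFin \o f) &
    forall s, 0 <= s -> s <= a ->
      ((g s - g 0)%:E = \int[leb]_(x in `]0%R, s]) (f x)%:E)%E.
Proof.
move=> a0 gnd gac; have [G GE] := ac_cumulative (ltW a0) gnd gac.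
pose D : set (measurableTypeR R) := `]0, a]%classic.
have mD : measurable D by exact: measurable_itv.
have Doo : (lebesgue_stieltjes_measure G D < +oo)%E.
  by rewrite LS_itvoc ?ltW// ltry.
pose nu : {finite_measure set (measurableTypeR R) -> \bar R} := mfrestr mD Doo.
have numu : nu `<< leb.
  apply/null_content_dominatesP => N mN N0.
  apply/eqP; rewrite eq_le measure_ge0 andbT; apply/lee_addgt0Pr => e e0.
  rewrite add0e; have [delta d0 H] := gac e e0.
  have N00 : (leb N < +oo)%E by rewrite N0 ltry.
  have [U [oU NU UN]] := lebesgue_regularity_outer mN N00 d0.
  have Ud : (leb U < delta%:E)%E.
    have mU : measurable U by exact: measurable_realfun.open_measurable.
    rewrite (measureDI leb mU mN) [X in (_ + X)%E](_ : _ = 0%E) ?adde0//.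
    by rewrite setIidr.
  apply: le_trans (ac_LS_open a0 GE H oU Ud).
  rewrite /nu /= /mfrestr /mrestr; apply: le_measure; rewrite ?inE.
  - exact: measurableI.
  - by apply: measurableI => //; exact: measurable_realfun.open_measurable.
  - exact: setSI.
pose f := Radon_Nikodym_SigmaFinite.f nu leb.
have ffin := Radon_Nikodym_SigmaFinite.f_fin_num numu.
have fE : EFin \o (fine \o f) = f by apply/funext => x /=; rewrite fineK// ffin.
exists (fine \o f).
  by rewrite fE; exact: Radon_Nikodym_SigmaFinite.f_integrable.
move=> s s0 sa.
rewrite [RHS](_ : _ = nu `]0, s]%classic); last first.
  rewrite (Radon_Nikodym_SigmaFinite.f_integral numu)//.
  by apply: eq_integral => x _; rewrite -[LHS]/((EFin \o (fine \o f)) x) fE.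
rewrite /nu /= /mfrestr /mrestr setIidl; last first.
  by move=> x; rewrite /D /= !in_itv/= => /andP[-> /le_trans]; apply.
by rewrite LS_itvoc// !GE !clamp_id// ltW.
Qed.

(** Jordan decomposition: with V the variation of [h] from 0, both V and V - h are nondecreasing and
    absolutely continuous on [0, a], and h is their difference. *)
Lemma ac_density a h : 0 < a -> ac_on a h ->
  exists2 f : R -> R, leb.-integrable setT (EFin \o f) &
    forall s, 0 <= s -> s <= a ->
      ((h s - h 0)%:E = \int[leb]_(x in `]0%R, s]) (f x)%:E)%E.
Proof.
move=> a0 hac; have bv := ac_on_bounded_variation (ltW a0) hac.
pose V t := fine (TV 0 t h).
have Vac : ac_on a V by apply: ac_on_variation => //; exact: ltW.
have Vnd : {in `[0, a] &, nondecreasing_fun V}.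
  move=> s t; rewrite !in_itv/= => /andP[s0 sa] /andP[t0 ta] st.
  by rewrite -subr_ge0 (TV_sub bv)// fine_ge0// total_variation_ge0.
have Wnd : {in `[0, a] &, nondecreasing_fun (V \- h)}.
  move=> s t; rewrite !in_itv/= => /andP[s0 sa] /andP[t0 ta] st.
  have : `|h t - h s| <= V t - V s.
    by rewrite (TV_sub bv)// -lee_fin fineK ?(TV_fin_num bv)// total_variation_ge.
  by move=> /(le_trans (ler_norm _)) /=; lra.
have [f1 if1 F1] := ac_nondecreasing_density a0 Vnd Vac.
have [f2 if2 F2] := ac_nondecreasing_density a0 Wnd (ac_onB Vac hac).
exists (f1 \- f2).
  by apply: (integrableB measurableT if1 if2).
move=> s s0 sa.
have sub (f : R -> R) : leb.-integrable setT (EFin \o f) -> leb.-integrable `]0, s] (EFin \o f).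
  by apply: integrableS.
under eq_integral do rewrite EFinB.
rewrite integralB//=; [|exact: sub..].
by rewrite -F1// -F2// -EFinB; congr EFin => /=; ring.
Qed.

Lemma ac_FTC a h : 0 < a -> ac_on a h ->
  exists f : R -> R, [/\ leb.-integrable setT (EFin \o f),
    (forall s, 0 <= s -> s <= a ->
      ((h s - h 0)%:E = \int[leb]_(x in `]0%R, s]) (f x)%:E)%E) &
    {ae leb, forall t, 0 < t < a -> derivable h t 1 /\ derive1 h t = f t}].
Proof.
move=> a0 hac; have [f fi fE] := ac_density a0 hac; exists f; split => //.
have fiS y : leb.-integrable [set` Interval (BRight 0) (BRight y)] (EFin \o f).
  by apply: integrableS fi.
have := FTC1 fiS (open_integrable_locally openT fi).
apply: (@filterS _ _ (ae_filter_ringOfSetsType leb)) => t H /andP[t0 ta].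
have [dF F'] := H t0.
set F := (fun x : R => _) in dF F'.
(* [h] equals the primitive of [f] plus [h 0] only on [0, a], which is a neighbourhood of the
   interior point [t]; the 0 is the derivative of the constant. *)
have : is_derive t 1 h (f t + 0).
  apply: (@near_eq_is_derive _ _ _ (F \+ cst (h 0))).
    near=> x; rewrite /= /F /Rintegral -fE ?subrK//.
    - by apply/ltW; near: x; exact: lt_nbhsr.
    - by apply/ltW; near: x; exact: lt_nbhsl.
  apply: is_deriveD.
  by rewrite -F' derive1E; exact: DeriveDef.
by case=> dh D; split; rewrite ?derive1E ?D ?addr0.
Unshelve. all: by end_near. Qed.

End AcFTC.

Section LowerIntegral.
Context (disp : measure_display) (T : measurableType disp) (R : realType).
Variable mu : {measure set T -> \bar R}.
Import HBNNSimple.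

(* [f] and [g] need not be measurable: the integral is a lower integral. *)
Lemma ge0_le_integral_ae (D : set T) (N : set T) (f g : T -> \bar R) :
  measurable N -> mu N = 0 ->
  (forall x, D x -> 0 <= f x) -> (forall x, 0 <= g x) ->
  (forall x, D x -> ~ N x -> f x <= g x) ->
  \int[mu]_(x in D) f x <= \int[mu]_x g x.
Proof.
move=> mN N0 f0 g0 fg; rewrite ge0_integralE// (ge0_integralTE _ g0).
apply: ge_ereal_sup => _ [/= phi phif <-].
have mNC : measurable (~` N) by exact: measurableC.
have pE x : proj_nnsfun phi mNC x = (phi \_ (~` N)) x by rewrite mrestrict.
(* Replacing a simple function below [f] by 0 on the null set [N] keeps its integral and brings it
   below [g] everywhere. *)
rewrite (_ : sintegral mu phi = sintegral mu (proj_nnsfun phi mNC)).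
  apply: ereal_sup_ubound; exists (proj_nnsfun phi mNC) => //= x.
  change (((proj_nnsfun phi mNC) x)%:E <= g x); rewrite pE patchE.
  case: ifPn => [|_]; last exact: g0.
  rewrite inE => NNx; apply: (le_trans (phif x)); rewrite patchE.
  by case: ifPn => [|_]; [rewrite inE => Dx; exact: fg|exact: g0].
rewrite -!integralT_nnsfun; apply: ge0_ae_eq_integral => //.
- exact/measurable_EFinP.
- exact/measurable_EFinP.
- by move=> x _; rewrite lee_fin.
- by move=> x _; rewrite lee_fin.
exists N; split => // x /= H; apply: contrapT => Nx; apply: H => _.
transitivity ((proj_nnsfun phi mNC x)%:E) => //.
by rewrite pE patchE ifT// inE.
Qed.

End LowerIntegral.

(** * A measurable version of the derivative of a path *)

Section AcPath.
Context {R : realType} (d : nat) (M : \bar R).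
Local Open Scope ring_scope.
Notation leb := (@lebesgue_measure R).

Lemma sqnormv_ge0 (x : 'rV[R]_d) : 0 <= sqnormv x.
Proof. by apply: sumr_ge0 => i _; rewrite -expr2 sqr_ge0. Qed.

Lemma le_normv (x : 'rV[R]_d) j : `|x ord0 j| <= normv x.
Proof.
rewrite -sqrtr_sqr /normv ler_wsqrtr// /sqnormv /dotv (bigD1 j)//= expr2 lerDl.
by apply: sumr_ge0 => i _; rewrite -expr2 sqr_ge0.
Qed.

Lemma abs_continuous_coord (h : R -> 'rV[R]_d) a j :
  abs_continuous M h -> time_set M a -> ac_on a (fun t => h t ord0 j).
Proof.
move=> hac Ma e e0; have [delta d0 H] := hac a Ma e e0; exists delta => // L pL lL sL.
have mL k : (k < size L)%N -> nth (0, 0) L k \in L by exact: mem_nth.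
have gen k : forall (L' : seq (R * R)) (z : R), (k.+1 < size L')%N -> path <=%R z (endpoints L') ->
    (nth (0, 0) L' k).2 <= (nth (0, 0) L' k.+1).1.
  elim: k => [|k ih] [|p L']//= z.
    by case: L' => // q L' _ /and4P[].
  by rewrite ltnS => kL /and3P[_ _]; exact: ih.
pose u k := (nth (0, 0) L k).1; pose v k := (nth (0, 0) L k).2.
have sumE (F : R * R -> R) : \sum_(p <- L) F p = \sum_(k < size L) F (nth (0, 0) L k).
  by rewrite (big_nth (0, 0)) big_mkord.
rewrite sumE; apply: (@le_trans _ _ (\sum_(k < size L) normv (h (v k) - h (u k)))).
  by apply: ler_sum => k _; have := le_normv (h (v k) - h (u k)) j; rewrite !mxE.
apply/ltW/H.
- by move=> k /mL /(mem_endpoints pL lL).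
- by move=> k kL; exact: (gen k L 0 kL pL).
- by move: sL; rewrite sumE.
Qed.

(* [f] is the limsup of the difference quotients of [h]: unlike [derive1 h], which
   is arbitrary where [h] is not derivable, it is measurable. *)
Lemma wpath_density (h : wpath R d M) : abs_continuous M h ->
  exists f : R -> 'rV[R]_d, [/\ forall j, measurable_fun setT (fun t => f t ord0 j),
    (forall a, time_set M a -> forall j,
      leb.-integrable `]0, a] (fun t => (f t ord0 j)%:E) /\
      ((h a ord0 j)%:E = \int[leb]_(t in `]0%R, a]) (f t ord0 j)%:E)%E) &
    {ae leb, forall t, open_time_set M t -> derive1 h t = f t}].
Proof.
move=> hac.
pose u j n t : \bar R := ((n.+1%:R) * (h (t + n.+1%:R^-1) ord0 j - h t ord0 j))%:E.
pose f t : 'rV[R]_d := \row_j fine (limn_esup (fun n => u j n t)).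
have mh j : measurable_fun setT (fun t => h t ord0 j).
  apply: continuous_measurable_fun => t.
  by apply: (@continuous_comp _ _ _ h (fun x : 'rV[R]_d => x ord0 j)); [exact: wval_continuous|exact: coord_continuous].
have mf j : measurable_fun setT (fun t => f t ord0 j).
  under eq_fun do rewrite mxE.
  apply: measurableT_comp => //; apply: measurable_fun_limn_esup => n.
  apply/measurable_EFinP; apply: measurable_funM => //; apply: measurable_funB => //.
  apply: (@measurableT_comp _ _ _ _ _ _ (fun t => h t ord0 j)) => //.
  exact: measurable_funD.
have df t : derivable h t 1 -> derive1 h t = f t.
  move=> dh; apply/rowP => j; rewrite mxE derive1E derive_mx// mxE.
  have dhj := (derivable_mxP h t 1).1 dh ord0 j.
  suff uc : u j n t @[n --> \oo] --> ('D_1 (fun t => h t ord0 j) t)%:E.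
    rewrite is_cvg_limn_esupE; last by apply/cvg_ex; eexists; exact: uc.
    by rewrite (cvg_lim _ uc).
  apply/cvg_EFin; first by apply: nearW.
  have cv : (fun n => (n.+1%:R^-1)^-1 *: (h (n.+1%:R^-1 *: 1 + t) ord0 j - h t ord0 j)) @ \oo
      --> 'D_1 (fun t => h t ord0 j) t.
    apply: (cvgr_dnbhsP _ _ _).1 dhj (fun n => n.+1%:R^-1) _.
    by split; [move=> n; rewrite invr_eq0 pnatr_eq0|exact: cvg_harmonic].
  apply: cvg_trans cv; apply: near_eq_cvg; apply: nearW => n /=.
  by rewrite invrK scaler1 [_^-1 + t]addrC.
have key a : 0 < a -> time_set M a ->
    (forall j, leb.-integrable `]0, a] (fun t => (f t ord0 j)%:E) /\
      ((h a ord0 j)%:E = \int[leb]_(t in `]0%R, a]) (f t ord0 j)%:E)%E) /\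
    {ae leb, forall t, 0 < t < a -> derive1 h t = f t}.
  move=> a0 Ma.
  have H j := ac_FTC a0 (abs_continuous_coord j hac Ma).
  have aed : {ae leb, forall t, 0 < t < a -> derivable h t 1}.
    have : \forall t \ae leb, forall j, 0 < t < a -> derivable (fun t => h t ord0 j) t 1.
      apply: (@filter_forall _ _ _ _ (ae_filter_ringOfSetsType leb)) => j.
      have [g [_ _]] := H j.
      by apply: (@filterS _ _ (ae_filter_ringOfSetsType leb)) => t /[apply] -[].
    apply: (@filterS _ _ (ae_filter_ringOfSetsType leb)) => t Ht ta.
    by apply/derivable_mxP => i j; rewrite ord1; exact: Ht.
  have aef : {ae leb, forall t, 0 < t < a -> derive1 h t = f t}.
    move: aed; apply: (@filterS _ _ (ae_filter_ringOfSetsType leb)) => t Ht ta.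
    by apply: df; exact: Ht.
  split => // j; have [g [gi gE gae]] := H j.
  have fg : ae_eq leb `]0, a]%classic (EFin \o g) (fun t => (f t ord0 j)%:E).
    (* The derivatives are known on the open interval, whereas the integral runs over ]0, a]; the
       endpoint is discarded as a null set. *)
    have aena : {ae leb, forall t, t != a}.
      exists [set a]; split; [exact: measurable_set1|exact: lebesgue_measure_set1|].
      by move=> t /= /negP; rewrite negbK => /eqP.
    have aedf : {ae leb, forall t, 0 < t < a -> derivable h t 1 /\ derive1 h t = f t}.
      move: aed aef; apply: (@filterS2 _ _ (ae_filter_ringOfSetsType leb)) => t H1 H2 ta.
      by split; [exact: H1|exact: H2].
    move: gae aedf aena.
    apply: (@filterS3 _ _ (ae_filter_ringOfSetsType leb)) => t gt ft ta.
    rewrite /= in_itv/= => /andP[t0 ta'].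
    have t0a : 0 < t < a by rewrite t0 lt_neqAle ta.
    have [dt <-] := gt t0a; have [dh <-] := ft t0a.
    by rewrite !derive1E derive_mx// mxE.
  have gi' : leb.-integrable `]0, a] (EFin \o g) by exact: integrableS gi.
  have mf' : measurable_fun `]0, a] (fun t => (f t ord0 j)%:E).
    by apply/measurable_EFinP; exact: measurable_funTS.
  have gm : measurable_fun `]0, a] (EFin \o g) by exact: measurable_int gi'.
  split.
    apply/integrableP; split => //; move/integrableP: gi' => [_].
    congr (_ < _)%E; apply: ae_eq_integral => //; try exact: measurableT_comp.
    move: fg; apply: (@filterS _ _ (ae_filter_ringOfSetsType leb)) => t E Dt.
    by rewrite E.
  have := gE a (ltW a0) (lexx a); rewrite (wval_start h (lexx 0)) mxE subr0 => ->.
  apply: ae_eq_integral => //.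
exists f; split => //.
  move=> a Ma j; have [a0|a0] := ltP 0 a; first exact: (key a a0 Ma).1.
  have -> : a = 0 by apply/eqP; rewrite eq_le a0; case: Ma => ->.
  by rewrite set_itvoc0 integral_set0 integrable_set0 (wval_start h (lexx 0)) mxE.
(* The exceptional set in [key] depends on [a]. For finite M the choice a = M suffices; for M =
   [+oo] the integers exhaust the half-line and countably many null sets are collected. *)
have [[a EM]|[EM|EM]] : (exists a : R, M = a%:E) \/ (M = +oo%E \/ M = -oo%E).
    by case: (M) => [a||]; [left; exists a|right; left|right; right].
- have lta t : open_time_set M t -> t < a by rewrite -lte_fin -EM => -[].
  have [a0|a0] := ltP 0 a.
    have Ma : time_set M a by rewrite /time_set /= EM; split; [exact: ltW|exact: lexx].
    have := (key a a0 Ma).2.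
    apply: (@filterS _ _ (ae_filter_ringOfSetsType leb)) => t H tM.
    by apply: H; rewrite lta//; case: tM => ->.
  apply: (@filterE _ _ (ae_filter_ringOfSetsType leb)) => t tM.
  by have := lta t tM; case: tM => t0 _ /(lt_trans t0)/lt_le_trans/(_ a0); rewrite ltxx.
- have : {ae leb, forall t, forall n, 0 < t < n.+1%:R -> derive1 h t = f t}.
    apply: ae_foralln => n; apply: (key _ _ _).2; rewrite ?ltr0n//.
    by rewrite /time_set /= EM; split; rewrite ?ler0n ?leey.
  apply: (@filterS _ _ (ae_filter_ringOfSetsType leb)) => t H [t0 _].
  apply: (H (Num.bound t)); rewrite t0/=.
  by rewrite (lt_trans (archi_boundP (ltW t0)))// ltr_nat.
- apply: (@filterE _ _ (ae_filter_ringOfSetsType leb)) => t tM.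
  have : (t%:E < -oo)%E by rewrite -EM; case: tM.
  by rewrite ltNge leNye.
Qed.

End AcPath.

(** * Directional derivatives *)

Section DirectionalDerivative.
Context {R : realType} {V : normedModType R}.
Local Open Scope ring_scope.
Implicit Types (f Du Dv : V -> R) (u v : V).

Definition has_dir_derive f v Dv := forall x, is_derive x v f (Dv x).

Lemma dir_derive_line f v Dv (x : V) (s : R) : has_dir_derive f v Dv ->
  is_derive s 1 (fun s => f (x + s *: v)) (Dv (x + s *: v)).
Proof.
move=> H; have [dv <-] := H (x + s *: v).
have E : (fun h : R => h^-1 *: (f (x + (h *: 1 + s) *: v) - f (x + s *: v))) =
         (fun h : R => h^-1 *: (f (h *: v + (x + s *: v)) - f (x + s *: v))).
  apply/funext => h; congr (_ *: (f _ - _)).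
  by rewrite /= [h *: 1]mulr1 scalerDl addrCA.
by split; rewrite ?/derivable ?/derive /= E.
Qed.

Lemma has_dir_derive0 f : has_dir_derive f 0 (fun=> 0).
Proof. by move=> x; split; [exact: derivable0|rewrite derive0]. Qed.

Lemma has_dir_deriveZ f v Dv (c : R) : has_dir_derive f v Dv ->
  has_dir_derive f (c *: v) (fun x => c * Dv x).
Proof.
move=> H x.
have [-> |c0] := eqVneq c 0.
  rewrite scale0r mul0r; exact: has_dir_derive0.
have [/cvg_ex[/= l cvv] lE] := H x.
have lDv : l = Dv x by rewrite -lE; apply/esym/cvg_lim.
rewrite {}lDv {lE} in cvv.
suff cvq : h^-1 *: (f (h *: (c *: v) + x) - f x) @[h --> 0^'] --> c * Dv x.
  by split; [apply/cvg_ex; eexists; exact: cvq|exact: cvg_lim cvq].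
apply/cvgr_dnbhsP => w [w0 cw].
have cwc : w n * c @[n --> \oo] --> 0 by rewrite -(mul0r c); exact: cvgMr_tmp.
have wc0 n : w n * c != 0 by rewrite mulf_neq0.
have := (cvgr_dnbhsP _ _ _).1 cvv (fun n => w n * c) (conj wc0 cwc).
move=> /(@cvgMl_tmp _ _ _ _ _ c); apply: cvg_trans; apply: near_eq_cvg; apply: nearW => n /=.
by rewrite scalerA invfM /GRing.scale/= mulrA [c * _]mulrCA divff// mulr1.
Qed.

(** The increment along u + v is split at x + h u. The second leg is h times [Dv] at an intermediate
    point by the mean value theorem, and continuity of [Dv] brings that point back to x. Full
    differentiability of [f] is thus avoided: continuous partial derivatives suffice to expand a
    derivative over the coordinates. *)
Lemma has_dir_deriveD f u v Du Dv : has_dir_derive f u Du -> has_dir_derive f v Dv ->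
  continuous Dv -> has_dir_derive f (u + v) (fun x => Du x + Dv x).
Proof.
move=> Hu Hv cv x.
suff cvq : h^-1 *: (f (h *: (u + v) + x) - f x) @[h --> 0^'] --> Du x + Dv x.
  by split; [apply/cvg_ex; eexists; exact: cvq|exact: cvg_lim cvq].
have [/cvg_ex[/= l cvu] lE] := Hu x.
have lDu : l = Du x by rewrite -lE; apply/esym/cvg_lim.
rewrite {}lDu {lE} in cvu.
have MVTv (h : R) : exists2 s : R, 0 <= s <= 1 &
    f (h *: (u + v) + x) - f (h *: u + x) = h * Dv ((h *: u + x) + s *: (h *: v)).
  have L s := dir_derive_line (h *: u + x) s (has_dir_deriveZ h Hv).
  have [s] := @MVT _ (fun s => f (h *: u + x + s *: (h *: v))) _ 0 1 ltr01 (fun s _ => L s)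
    (derivable_within_continuous (fun s _ => @ex_derive _ _ _ _ _ _ _ (L s))).
  rewrite in_itv/= => /andP[s0 s1]; rewrite subr0 mulr1 scale1r scale0r addr0 => E.
  exists s; first by rewrite !ltW.
  by rewrite -E scalerDr addrAC.
(* [q h] is the difference quotient of the leg along v, with the intermediate point chosen for each
   h; its argument is within |h| (|u| + |v|) of x. *)
pose q (h : R) := Dv ((h *: u + x) + sval (cid2 (MVTv h)) *: (h *: v)).
have cvq : q h @[h --> 0^'] --> Dv x.
  apply/cvgrPdist_lt => e e0.
  have /cvgrPdist_lt/(_ e e0)/nbhs_ballP[r /= r0 xr] := cv x.
  near=> h; apply: xr; rewrite /q; case: cid2 => s /= /andP[s0 s1] _.
  rewrite -ball_normE /= addrAC opprD addrCA subrr addr0 normrN.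
  rewrite scalerA [s * h]mulrC -scalerA -scalerDr normrZ.
  have hr : `|h| * (`|u| + `|v| + 1) < r.
    rewrite -ltr_pdivlMr ?ltr_wpDl ?addr_ge0//; near: h; apply: dnbhs0_lt.
    by rewrite divr_gt0// ltr_wpDl ?addr_ge0.
  apply: le_lt_trans hr; rewrite ler_wpM2l// (le_trans (ler_normD _ _))// -addrA lerD2l.
  by rewrite normrZ ger0_norm// (le_trans (ler_piMl _ s1))// lerDl.
have : (q h + h^-1 *: (f (h *: u + x) - f x)) @[h --> 0^'] --> Dv x + Du x.
  exact: cvgD.
rewrite [Dv x + _]addrC; apply: cvg_trans; apply: near_eq_cvg.
near=> h.
have h0 : h != 0 by near: h; exact: nbhs_dnbhs_neq.
rewrite /q; case: cid2 => s /= _ E.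
apply: (mulfI h0); rewrite mulrDr -E mulrA divff// mul1r.
by rewrite [h * (_ *: _)]mulrA divff// mul1r subrKA.
Unshelve. all: by end_near. Qed.

End DirectionalDerivative.

Section Gradient.
Context {R : realType} (n d : nat).
Local Open Scope ring_scope.
Implicit Types (f : 'M[R]_(n, d) -> R) (A B : 'M[R]_(n, d)).

(** The derivative of [f] at the point [A] in the direction [B], written out in partial derivatives
    so that linearity in [B], measurability and bounds are immediate. *)
Definition grad f B A : R :=
  \sum_(p : 'I_n * 'I_d) B p.1 p.2 * 'D_(delta_mx p.1 p.2) f A.

Lemma Cb1_has_dir_derive f B : Cb 1 f -> has_dir_derive f B (grad f B).
Proof.
move=> [_ _ Hf].
rewrite [X in has_dir_derive _ X](_ : B = \sum_(p : 'I_n * 'I_d) B p.1 p.2 *: delta_mx p.1 p.2); last first.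
  by rewrite {1}[B]matrix_sum_delta pair_bigA.
rewrite /grad; elim: (index_enum _) => [|p s ih].
  rewrite big_nil [X in has_dir_derive _ _ X](_ : _ = fun=> 0); first exact: has_dir_derive0.
  by apply/funext => A; rewrite big_nil.
rewrite big_cons addrC [X in has_dir_derive _ _ X](_ : _ =
    fun A => \sum_(j <- s) B j.1 j.2 * 'D_(delta_mx j.1 j.2) f A +
             B p.1 p.2 * 'D_(delta_mx p.1 p.2) f A); last first.
  by apply/funext => A; rewrite big_cons addrC.
have [df [cdf _ _]] := Hf p.1 p.2.
apply: has_dir_deriveD => //.
  by apply: has_dir_deriveZ => A; exact: DeriveDef.
by move=> A; exact: (@cvgMl_tmp _ _ _ _ _ _ _ (cdf A)).
Qed.

Lemma continuous_grad f B : Cb 1 f -> continuous (grad f B).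
Proof.
move=> [_ _ Hf]; apply: continuous_big => [|p _ A]; first exact: add_continuous.
have [_ [cdf _ _]] := Hf p.1 p.2; exact: (@cvgMl_tmp _ _ _ _ _ _ _ (cdf A)).
Qed.

Lemma bounded_grad f : Cb 1 f -> exists2 C : R, 0 <= C & forall B A,
  `|grad f B A| <= C * \sum_(p : 'I_n * 'I_d) `|B p.1 p.2|.
Proof.
move=> [_ _ Hf].
have /choice[C HC] (p : 'I_n * 'I_d) : exists C, forall A, `|'D_(delta_mx p.1 p.2) f A| <= C.
  by have [_ [_ Cf _]] := Hf p.1 p.2.
have C0 p : 0 <= C p by apply: le_trans (HC p 0).
exists (\sum_p C p); first exact: sumr_ge0.
move=> B A; rewrite mulr_sumr; apply: le_trans (ler_norm_sum _ _ _) _.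
apply: ler_sum => p _; rewrite normrM mulrC ler_wpM2r//.
by apply: le_trans (HC p A) _; rewrite (bigD1 p)//= lerDl sumr_ge0.
Qed.

End Gradient.

Section DhFormula.
Context {R : realType} (d : nat).
Local Open Scope ring_scope.

Definition evalmx n (s : 'I_n -> R) (w : R -> 'rV[R]_d) : 'M[R]_(n, d) :=
  \matrix_(i, j) w (s i) ord0 j.

Definition wpath_shift (M : \bar R) (w h : wpath R d M) (e : R) : wpath R d M.
Proof.
refine (@WPath R d M (fun t => w t + e *: h t) _ _ _).
- move=> t; have cw := @wval_continuous _ _ _ w t.
  have ch : (fun t => e *: h t) @ t --> e *: h t.
    by apply: cvgZ; [exact: cvg_cst|exact: (@wval_continuous _ _ _ h t)].
  exact: (cvgD cw ch).
- by move=> t t0; rewrite !wval_start// scaler0 addr0.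
- by move=> t tM; rewrite (wval_stop w tM) (wval_stop h tM).
Defined.

Lemma Dh_grad (T M : \bar R) (h : wpath R d M) n (f : 'M[R]_(n, d) -> R) (t : 'I_n -> R)
    (F : (R -> 'rV[R]_d) -> R) (w : wpath R d M) (l : spath T) :
  Cb 1 f ->
  (forall o, Omega T M o -> F o = f (\matrix_(i < n, j < d) o (t i) ord0 j)) ->
  Dh h F (w, l) = grad f (evalmx (l \o t) h) (evalmx (l \o t) w).
Proof.
move=> Cf HF; rewrite /Dh /=.
have [/cvg_ex[/= c cv] E] := Cb1_has_dir_derive (evalmx (l \o t) h) Cf (evalmx (l \o t) w).
rewrite -E /derive.
suff -> : (fun e : R => e^-1 * (F (fun t => w (l t) + e *: h (l t)) - F (w \o l))) =
    (fun e : R => e^-1 *: (f (e *: evalmx (l \o t) h + evalmx (l \o t) w) -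
                           f (evalmx (l \o t) w))) by [].
apply/funext => e.
rewrite (HF (w \o l)); last by exists w, l.
rewrite (HF (fun t => w (l t) + e *: h (l t))); last by exists (wpath_shift w h e), l.
congr (_ * (f _ - f _)).
by apply/matrixP => i j; rewrite !mxE addrC.
Qed.

Lemma on_paths_evalmx (T M : \bar R) n (f : 'M[R]_(n, d) -> R) (t : 'I_n -> R)
    (F : (R -> 'rV[R]_d) -> R) (w : wpath R d M) (l : spath T) :
  (forall o, Omega T M o -> F o = f (\matrix_(i < n, j < d) o (t i) ord0 j)) ->
  on_paths F (w, l) = f (evalmx (l \o t) w).
Proof. by move=> HF; rewrite /on_paths HF//; exists w, l. Qed.

End DhFormula.

(** * Measurability of path functionals *)

Section CountableGluing.
Context (disp : measure_display) (T : measurableType disp) (R : realType).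
Local Open Scope ring_scope.

Lemma measurable_fun_glue (C : countType) (g : T -> C) (phi : C -> T -> R) :
  (forall c, measurable [set x | g x = c]) ->
  (forall c, measurable_fun setT (phi c)) ->
  measurable_fun setT (fun x => phi (g x) x).
Proof.
move=> mg mphi _ B mB; rewrite setTI.
rewrite [X in measurable X](_ : _ = \bigcup_c ([set x | g x = c] `&` phi c @^-1` B)).
  apply: countable_bigcupT_measurable => [|c]; first exact: countableP.
  by apply: measurableI => //; rewrite -[X in measurable X]setTI; exact: mphi.
apply/seteqP; split => [x Bx|x [c _ [/= <-]]] //.
by exists (g x).
Qed.

Definition grid (k : nat) (x : R) : int := Num.floor (x * k.+1%:R).
Definition ungrid (k : nat) (z : int) : R := z%:~R / k.+1%:R.

Lemma grid_dist k x : `|x - ungrid k (grid k x)| <= k.+1%:R^-1.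
Proof.
have k0 : 0 < k.+1%:R :> R by [].
have -> : x - ungrid k (grid k x) = (x * k.+1%:R - (grid k x)%:~R) / k.+1%:R.
  by rewrite /ungrid mulrBl mulfK// gt_eqF.
rewrite normrM [X in _ * X]gtr0_norm ?invr_gt0// ler_piMl ?invr_ge0//.
have := Num.Theory.floor_itv (x * k.+1%:R); rewrite /grid intrD => /andP[h1 h2].
by rewrite ger0_norm; lra.
Qed.

Lemma cvg_grid x : ungrid k (grid k x) @[k --> \oo] --> x.
Proof.
apply/cvgrPdist_le => e e0.
have /cvgrPdist_le/(_ e e0) := @cvg_harmonic R.
apply: filterS => k; rewrite sub0r normrN /harmonic ger0_norm ?invr_ge0//.
exact/le_trans/grid_dist.
Qed.

Lemma measurable_grid k (X : T -> R) (c : int) : measurable_fun setT X ->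
  measurable [set x | grid k (X x) = c].
Proof.
move=> mX.
rewrite [X in measurable X](_ : _ = (fun x => X x * k.+1%:R) @^-1` `[c%:~R, (c + 1)%:~R[%classic).
  rewrite -[X in measurable X]setTI.
  by apply: (measurable_funM mX (measurable_cst _)) => //; exact: measurable_itv.
apply/seteqP; split => x /=.
  by move=> <-; rewrite in_itv/=; exact: Num.Theory.floor_itv.
by rewrite in_itv/= => /Num.Theory.floor_def.
Qed.

(* Matrices carry no sigma-algebra here: [X] is approximated by matrices on a grid,
   which take countably many values. *)
Lemma measurable_continuous_mx n d (f : 'M[R]_(n, d) -> R) (X : T -> 'M[R]_(n, d)) :
  continuous f -> (forall i j, measurable_fun setT (fun x => X x i j)) ->
  measurable_fun setT (fun x => f (X x)).
Proof.
move=> cf mX.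
pose g k x : 'M[int]_(n, d) := \matrix_(i, j) grid k (X x i j).
pose u k x := f (\matrix_(i, j) ungrid k (g k x i j)).
apply: (@measurable_fun_cvg _ _ _ setT u) => //.
  move=> k; apply: (@measurable_fun_glue _ (g k) (fun c _ => f (\matrix_(i, j) ungrid k (c i j)))) => // c.
  rewrite [X in measurable X](_ : _ = \bigcap_(p in [set: 'I_n * 'I_d])
      [set x | grid k (X x p.1 p.2) = c p.1 p.2]).
    by apply: fin_bigcap_measurable => // p _; exact: measurable_grid.
  apply/seteqP; split => [x /= <- p _|x /= H]; first by rewrite !mxE.
  by apply/matrixP => i j; rewrite !mxE (H (i, j)).
move=> x _; apply: continuous_cvg; first exact: cf.
apply/cvgrPdist_lt => e e0.
have /cvgrPdist_lt/(_ e e0) := @cvg_harmonic R.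
apply: filterS => k; rewrite sub0r normrN /harmonic ger0_norm ?invr_ge0// => ke.
rewrite /Num.Def.normr/= mx_normrE; apply: bigmax_lt => // -[i j] _ /=.
by rewrite !mxE; apply: le_lt_trans ke; exact: grid_dist.
Qed.

End CountableGluing.

Section PathMeasurability.
Context (R : realType) (d : nat) (T M : \bar R).
Local Open Scope ring_scope.

Lemma measurable_wcoord (t : R) (i : 'I_d) :
  measurable_fun setT (fun w : wspace R d M => (w : wpath R d M) t ord0 i).
Proof.
move=> _ B mB; rewrite setTI; apply: sub_gen_smallest.
by exists t, i, B.
Qed.

Lemma measurable_scoord (t : R) :
  measurable_fun setT (fun l : sspace T => (l : spath T) t).
Proof.
move=> _ B mB; rewrite setTI; apply: sub_gen_smallest.
by exists t, B.
Qed.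

(** Paths are continuous, so the value at a random time is the limit of the values at the times
    rounded to finer and finer grids; a rounded time takes countably many values, at each of which
    the evaluation is a coordinate of the path. *)
Lemma measurable_weval (disp : measure_display) (O : measurableType disp)
    (X : O -> wspace R d M) (Y : O -> R) (i : 'I_d) :
  measurable_fun setT X -> measurable_fun setT Y ->
  measurable_fun setT (fun o => (X o : wpath R d M) (Y o) ord0 i).
Proof.
move=> mX mY.
apply: (@measurable_fun_cvg _ _ _ setT
    (fun k o => (X o : wpath R d M) (ungrid R k (grid k (Y o))) ord0 i)).
  move=> k; apply: (@measurable_fun_glue _ _ _ _ (fun o => grid k (Y o))
      (fun c o => (X o : wpath R d M) (ungrid R k c) ord0 i)).
    by move=> c; exact: measurable_grid.
  move=> c.
  exact: (measurableT_comp (measurable_wcoord (ungrid R k c) i) mX).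
move=> o _.
have ct : continuous (fun t => (X o : wpath R d M) t ord0 i).
  move=> t; apply: (@continuous_comp _ _ _ (X o : wpath R d M) (fun x : 'rV[R]_d => x ord0 i)).
    exact: wval_continuous.
  exact: coord_continuous.
exact: (cvg_comp _ _ (@cvg_grid _ (Y o)) (ct (Y o))).
Qed.

Lemma terminalE (l : spath T) : (forall r, T <> r%:E) ->
  terminal l = ereal_sup (range (fun t : R => (l t)%:E)).
Proof.
move=> Tr; have -> : terminal l = lim ((l t)%:E @[t --> +oo%R]).
  by rewrite /terminal; case: (T) Tr (l) => [r /(_ r)//||].
apply: cvg_lim => //; apply: nondecreasing_cvge => s t st.
by rewrite lee_fin; exact: lval_nondecreasing.
Qed.

Lemma le_terminal (l : spath T) (t : R) : time_set T t -> ((l t)%:E <= terminal l)%E.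
Proof.
case=> _ tT; have [[r Tr]|Tr] := pselect (exists r, T = r%:E).
  have -> : terminal l = (l r)%:E by rewrite /terminal; case: (T) Tr (l) => [_ [->]||].
  by rewrite lee_fin; apply: lval_nondecreasing; rewrite -lee_fin -Tr.
rewrite terminalE => [|r Tr']; last by apply: Tr; exists r.
by apply: ereal_sup_ubound; exists t.
Qed.

Lemma measurable_terminal : measurable_fun setT (@terminal R T : sspace T -> \bar R).
Proof.
have [[r Tr]|Tr] := pselect (exists r, T = r%:E).
  have -> : (@terminal R T : sspace T -> \bar R) = (fun l : sspace T => ((l : spath T) r)%:E).
    by apply/funext => l; rewrite /terminal; case: (T) Tr (l) => [_ [->]||].
  by apply/measurable_EFinP; exact: measurable_scoord.
(* Monotone paths have the same limit along the integers, which involves only countably many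
   coordinates. *)
have -> : (@terminal R T : sspace T -> \bar R) =
    (fun l : sspace T => limn_esup (fun n : nat => ((l : spath T) n%:R)%:E)).
  apply/funext => l; rewrite is_cvg_limn_esupE; last first.
    by apply: ereal_nondecreasing_is_cvgn => m n mn; rewrite lee_fin; apply: lval_nondecreasing; rewrite ler_nat.
  rewrite terminalE; last by move=> r Tr0; apply: Tr; exists r.
  apply/esym/cvg_lim => //.
  have /(cvg_comp _ _ (@cvgr_idn R)) := nondecreasing_cvge (fun s t st =>
     (lval_nondecreasing l st : (EFin (l s) <= EFin (l t))%E)).
  exact.
apply: measurable_fun_limn_esup => n.
by apply/measurable_EFinP; exact: measurable_scoord.
Qed.

End PathMeasurability.

(** * Gaussian integration by parts *)

Section GaussianIBP.
Context {R : realType}.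
Local Open Scope ring_scope.
Notation leb := (@lebesgue_measure R).

(** The change of variables formula is expressed with the Radon-Nikodym derivative; this identifies
    it with the explicit Gaussian density. *)
Lemma normal_density_ae (s : R) : ae_eq leb setT
  (Radon_Nikodym_SigmaFinite.f (normal_prob 0 s) leb) (fun x => (normal_pdf 0 s x)%:E).
Proof.
have dom := normal_prob_dominates 0 s.
apply: integral_ae_eq => //.
- exact: Radon_Nikodym_SigmaFinite.f_integrable.
- by apply/measurable_EFinP; exact: measurable_normal_pdf.
- move=> A _ mA; rewrite -Radon_Nikodym_SigmaFinite.f_integral//.
Qed.

Lemma ge0_integral_normal (s : R) (f : R -> \bar R) : measurable_fun setT f ->
  (forall x, (0 <= f x)%E) ->
  (\int[normal_prob 0%R s]_x f x = \int[leb]_x (f x * (normal_pdf 0%R s x)%:E))%E.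
Proof.
move=> mf f0; have dom := normal_prob_dominates 0 s.
rewrite -(Radon_Nikodym_SigmaFinite.change_of_variables dom)//.
have mpdf : measurable_fun setT (fun x => (normal_pdf 0 s x)%:E).
  by apply/measurable_EFinP; exact: measurable_normal_pdf.
apply: ae_eq_integral => //.
- apply: emeasurable_funM => //.
  exact: measurable_int (Radon_Nikodym_SigmaFinite.f_integrable dom).
- exact: emeasurable_funM.
- exact/ae_eqe_mul2l/normal_density_ae.
Qed.

Lemma integral_normal (s : R) (f : R -> R) : (normal_prob 0 s).-integrable setT (EFin \o f) ->
  leb.-integrable setT (fun x => (f x * normal_pdf 0 s x)%:E) /\
  (\int[normal_prob 0%R s]_x (f x)%:E = \int[leb]_x (f x * normal_pdf 0%R s x)%:E)%E.
Proof.
move=> intf; have mf := measurable_int _ intf.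
have mf' : measurable_fun setT f by exact/measurable_EFinP.
have mpdf := measurable_normal_pdf 0 s.
have abs_lty : (\int[leb]_x `|(f x * normal_pdf 0 s x)%:E| < +oo)%E.
  have /integrableP[_] := intf; rewrite ge0_integral_normal//; last exact: measurableT_comp.
  congr (_ < _)%E; apply: eq_integral => x _ /=.
  by rewrite -EFinM normrM (ger0_norm (normal_pdf_ge0 _ _ _)).
split.
  by apply/integrableP; split => //; apply/measurable_EFinP; exact: measurable_funM.
rewrite integralE [RHS]integralE.
rewrite !ge0_integral_normal//; [|exact: measurable_funeneg|exact: measurable_funepos].
by congr (_ - _)%E; apply: eq_integral => x _;
  rewrite ?funeposE ?funenegE/= -?EFinN -!EFin_max -EFinM;
  congr EFin; rewrite maxr_pMl ?normal_pdf_ge0// mul0r ?mulNr.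
Qed.

(** Doubling the standard deviation leaves a factor exp (- 3 x^2 / (8 s^2)) to spare, which absorbs
    |x|. This one bound gives both the integrability of x and the decay of the boundary terms in
    [gaussian_IBP]. *)
Lemma normal_pdf_decay (s : R) : 0 < s -> exists2 C, 0 <= C &
  forall x, `|x| * normal_pdf 0 s x <= C * normal_pdf 0 (2 * s) x.
Proof.
move=> s0; have s20 : 0 < 2 * s by rewrite mulr_gt0.
have p0 t : 0 < t -> 0 < normal_peak t :> R by move=> t0; rewrite normal_peak_gt0// gt_eqF.
have sp := p0 _ s0; have s2p := p0 _ s20.
exists (s * normal_peak s / normal_peak (2 * s)).
  by rewrite divr_ge0 ?mulr_ge0// ltW.
move=> x; rewrite /normal_pdf !gt_eqF//.
rewrite [leRHS]mulrA divfK ?gt_eqF// mulrCA [s * _]mulrC -[leRHS]mulrA.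
rewrite ler_pM2l// /normal_fun subr0.
have -> : - x ^+ 2 / (s ^+ 2 *+ 2) = - x ^+ 2 / ((2 * s) ^+ 2 *+ 2) - x ^+ 2 * 3 / (8 * s ^+ 2).
  by field; rewrite gt_eqF.
rewrite expRD mulrCA [s * _]mulrC ler_pM2l ?expR_gt0// expRN ler_pdivrMr ?expR_gt0//.
apply: le_trans (_ : _ <= s * (1 + x ^+ 2 * 3 / (8 * s ^+ 2))) _; last first.
  by rewrite ler_pM2l// expR_ge1Dx.
set y := `|x| / s; have xE : `|x| = s * y by rewrite mulrC divfK// gt_eqF.
have -> : x ^+ 2 * 3 / (8 * s ^+ 2) = 3 / 8 * y ^+ 2.
  rewrite -(real_normK (num_real x)) xE; field; rewrite gt_eqF//.
(* The remaining claim is y <= 1 + 3 y^2 / 8, whose sides differ by 3/8 (y - 4/3)^2 + 1/3. *)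
rewrite xE ler_pM2l//; have := sqr_ge0 (y - 4 / 3); rewrite -subr_ge0.
by move=> H; have : 0 <= 3 / 8 * (y - 4 / 3) ^+ 2 + 1 / 3; [rewrite addr_ge0// mulr_ge0|]; nra.
Qed.

Lemma integrable_normal_id (s : R) : 0 < s ->
  (normal_prob 0 s).-integrable setT (fun x => x%:E).
Proof.
move=> s0; apply/integrableP; split; first exact/measurable_EFinP.
rewrite ge0_integral_normal//; last exact: measurableT_comp.
have [C C0 HC] := normal_pdf_decay s0.
apply: (@le_lt_trans _ _ (\int[leb]_x (C%:E * (normal_pdf 0%R (2 * s) x)%:E))%E).
  apply: ge0_le_integral => //=.
  - by move=> x _; rewrite -EFinM lee_fin mulr_ge0// normal_pdf_ge0.
  - by apply/measurable_EFinP; apply: measurable_funM => //; exact: measurable_normal_pdf.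
  - by apply/measurable_EFinP; apply: measurable_funM => //; exact: measurable_normal_pdf.
  - by move=> x _; rewrite -!EFinM lee_fin.
rewrite ge0_integralZl//; last first.
- by move=> x _; rewrite lee_fin normal_pdf_ge0.
- by apply/measurable_EFinP; exact: measurable_normal_pdf.
by rewrite integral_normal_pdf mule1 ltry.
Qed.

Lemma is_derive_normal_pdf (s x : R) : s != 0 ->
  is_derive x 1 (normal_pdf 0 s) (- (x / s ^+ 2) * normal_pdf 0 s x).
Proof.
move=> s0; rewrite normal_pdfE//.
have -> : (fun t => normal_peak s * normal_fun 0 s t) =
   (fun t => normal_peak s * expR (- (t - 0) ^+ 2 / (s ^+ 2 *+ 2))) by [].
apply: is_derive_eq.
rewrite /normal_fun !subr0 /GRing.scale/=.
by field; rewrite s0.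
Qed.

(** The density p satisfies p' = - x p / s^2, so dpsi p - psi x p / s^2 is the derivative of psi p.
    Its integral over a symmetric interval consists of boundary terms, which vanish as the interval
    grows. *)
Lemma gaussian_IBP (s C : R) (psi dpsi : R -> R) : 0 < s ->
  (forall x : R, is_derive x 1 psi (dpsi x)) -> continuous dpsi ->
  (forall x, `|psi x| <= C) -> (forall x, `|dpsi x| <= C) ->
  (\int[normal_prob 0%R s]_x (psi x * x)%:E =
   (s ^+ 2)%:E * \int[normal_prob 0%R s]_x (dpsi x)%:E)%E.
Proof.
move=> s0 dpsiE cdpsi psiC dpsiC.
have sN0 : s != 0 by rewrite gt_eqF.
have C0 : 0 <= C by apply: le_trans (psiC 0).
have cpsi : continuous psi.
  by move=> x; apply: differentiable_continuous; apply/derivable1_diffP; exact: (@ex_derive _ _ _ _ _ _ _ (dpsiE x)).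
have mpsi := continuous_measurable_fun cpsi.
have mdpsi := continuous_measurable_fun cdpsi.
have int1 : (normal_prob 0 s).-integrable setT (EFin \o (fun x => psi x * x)).
  have mpx : measurable_fun setT (EFin \o (fun x => psi x * x)).
    by apply/measurable_EFinP; exact: measurable_funM.
  have Ix := integrableZl measurableT C (integrable_normal_id s0).
  apply: (le_integrable _ _ _ Ix) => // x _ /=.
  by rewrite lee_fin !normrM (ger0_norm C0) ler_wpM2r.
have int2 : (normal_prob 0 s).-integrable setT (EFin \o dpsi).
  apply: measurable_bounded_integrable => //; last first.
    by exists C; split; [exact: num_real|move=> y Cy x _; exact: le_trans (dpsiC x) (ltW Cy)].
  by rewrite /= [X in (X < _)%E]probability_setT ltry.
have [I1 ->] := integral_normal int1; have [I2 ->] := integral_normal int2.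
pose p := normal_pdf 0 s.
pose f x := dpsi x * p x - (psi x * x * p x) / s ^+ 2.
have fE : EFin \o f = ((fun x => (dpsi x * p x)%:E) \- (fun x => (s ^- 2)%:E * (psi x * x * p x)%:E))%E.
  by apply/funext => x /=; rewrite /f [X in _ - X]mulrC.
have If : leb.-integrable setT (EFin \o f).
  by rewrite fE; apply: integrableB => //; exact: integrableZl.
have fE2 : (\int[leb]_x (f x)%:E = \int[leb]_x (dpsi x * p x)%:E - (s ^- 2)%:E * \int[leb]_x (psi x * x * p x)%:E)%E.
  transitivity (\int[leb]_x (EFin \o f) x)%E => //.
  rewrite fE integralB//; last exact: integrableZl.
  by rewrite integralZl.
suff f0 : (\int[leb]_x (f x)%:E = 0)%E.
  have := integrable_fin_num measurableT I1; have := integrable_fin_num measurableT I2.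
  move: f0; rewrite fE2 -/p.
  case: (\int[leb]_x (dpsi x * p x)%:E)%E => [u||]//; case: (\int[leb]_x (psi x * x * p x)%:E)%E => [v||]//.
  rewrite -!EFinM -EFinB => -[uv] _ _; congr EFin.
  have {uv} -> : u = s ^- 2 * v by apply/eqP; rewrite -subr_eq0 uv.
  by rewrite mulrA divff ?mul1r// expf_neq0.
have cp : continuous p by exact: continuous_normal_pdf.
have cf : continuous f.
  move=> x; apply: cvgB.
    by apply: cvgM; [exact: cdpsi|exact: cp].
  apply: cvgMr_tmp; apply: cvgM; last exact: cp.
  by apply: cvgM; [exact: cpsi|exact: cvg_id].
have dF (x : R) : is_derive x 1 (fun x => psi x * p x) (f x).
  have dp := is_derive_normal_pdf x sN0; have dpx := dpsiE x.
  apply: is_derive_eq; rewrite /f /p /GRing.scale/=; field; rewrite sN0//.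
have cF : continuous (fun x => psi x * p x).
  by move=> x; apply: cvgM; [exact: cpsi|exact: cp].
have fN (N : nat) : (\int[leb]_(x in `[(- N.+1%:R)%R, (N.+1%:R)%R]) (f x)%:E =
    (psi N.+1%:R * p N.+1%:R - psi (- N.+1%:R) * p (- N.+1%:R))%:E)%E.
  rewrite (@continuous_FTC2 _ f (fun x => psi x * p x)) ?EFinB//.
  - by rewrite gtrN.
  - exact: continuous_subspaceT.
  - split.
    + by move=> x _; exact: (@ex_derive _ _ _ _ _ _ _ (dF x)).
    + by apply: cvg_at_right_filter; exact: cF.
    + by apply: cvg_at_left_filter; exact: cF.
  - by move=> x _; rewrite derive1E; exact: (@derive_val _ _ _ _ _ _ _ (dF x)).
have cv1 : (\int[leb]_(x in `[(- N.+1%:R)%R, (N.+1%:R)%R]) (f x)%:E @[N --> \oo] --> \int[leb]_x (f x)%:E)%E.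
  pose g (N : nat) : R -> \bar R := (EFin \o f) \_ `[- N.+1%:R, N.+1%:R].
  have gE N : (\int[leb]_(x in `[(- N.+1%:R)%R, (N.+1%:R)%R]) (f x)%:E = \int[leb]_x (g N x))%E.
    by rewrite integral_mkcond.
  under eq_fun do rewrite gE.
  have mf := measurable_int _ If.
  have mg N : measurable_fun setT (g N).
    by apply/(measurable_restrictT _ _).1 => //; exact: measurable_funTS.
  have gf : {ae leb, forall x, setT x -> g ^~ x @ \oo --> (EFin \o f) x}.
    apply: aeW => x _; apply: cvg_near_cst; exists (Num.bound `|x|) => // N /= xN.
    rewrite /g patchE ifT// inE/= in_itv/= -ler_norml.
    apply: (le_trans (ltW (archi_boundP (normr_ge0 x)))).
    by rewrite ler_nat (leq_trans xN).
  have gub : {ae leb, forall x N, setT x -> (`|g N x| <= (abse \o (EFin \o f)) x)%E}.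
    apply: aeW => x N _; rewrite /g patchE; case: ifPn => _ //=.
    by rewrite normr0 lee_fin.
  by have [_ _] := @dominated_convergence _ _ _ leb setT measurableT g (EFin \o f)
    (abse \o (EFin \o f)) mg mf gf (integrable_abse If) gub.
have [K K0 HK] := normal_pdf_decay s0.
(* [psi] is bounded by [C], and |t| p(t) by [K] times the maximum of the wider Gaussian density; so
   the boundary terms are O(1/N). *)
pose K' := C * (K * normal_peak (2 * s)).
have ub (t : R) : t != 0 -> `|psi t * p t| <= K' / `|t|.
  move=> t0; rewrite ler_pdivlMr ?normr_gt0// normrM (ger0_norm (normal_pdf_ge0 _ _ _)).
  rewrite -mulrA; apply: ler_pM => //; first by rewrite mulr_ge0// normal_pdf_ge0.
  rewrite mulrC; apply: (le_trans (HK t)); rewrite ler_wpM2l//.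
  by apply: normal_pdf_ub; rewrite mulf_neq0.
have cv2 : ((psi N.+1%:R * p N.+1%:R - psi (- N.+1%:R) * p (- N.+1%:R))%:E @[N --> \oo] --> 0)%E.
  apply/cvg_EFin; first exact: nearW.
  apply/norm_cvg0P.
  apply: (@squeeze_cvgr _ _ _ _ (fun=> 0) (fun N => 2 * K' * N.+1%:R^-1)).
  - apply: nearW => N /=; rewrite normr_ge0/=.
    apply: (le_trans (ler_normB _ _)).
    rewrite -mulrA mulr_natl mulr2n; apply: lerD.
      by have := ub N.+1%:R; rewrite pnatr_eq0 normr_nat; apply.
    by have := ub (- N.+1%:R); rewrite oppr_eq0 pnatr_eq0 normrN normr_nat; apply.
  - exact: cvg_cst.
  - by rewrite -(mulr0 (2 * K')); apply: cvgMl_tmp; exact: cvg_harmonic.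
have <- := cvg_lim _ cv1 => //.
by under eq_fun do rewrite fN; exact: cvg_lim cv2.
Qed.

End GaussianIBP.

(** * One coordinate of an independent family against all the others *)

Section IndependentCoordinate.
Context (disp : measure_display) (O : measurableType disp) (R : realType).
Context (P : probability O R) (I : finType) (X : I -> O -> R) (q : I).
Local Open Scope ring_scope.
Hypothesis mX : forall i, measurable_fun setT (X i).
Hypothesis indX : mutually_independent P X.

(* The family of the [X i] with [i != q] is seen as a random variable with values
   in [I -> R], with the sigma-algebra that ignores the coordinate [q]. *)
Definition off_rect : set (set (I -> R)) :=
  [set A | exists2 B : I -> set R, (forall k, measurable (B k)) &
    A = [set z | forall k, k != q -> B k (z k)]].

Definition off_space : Type := g_sigma_algebraType off_rect.
HB.instance Definition _ := Measurable.on off_space.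

Definition off (o : O) : off_space := fun k => X k o.

Lemma measurable_forall (Q : I -> set R) : (forall k, measurable (Q k)) ->
  forall C : pred I, measurable [set o | forall k, C k -> Q k (X k o)].
Proof.
move=> mQ C.
rewrite [X in measurable X](_ : _ = \bigcap_(k in [set k | C k]) (X k @^-1` Q k)) //.
apply: fin_bigcap_measurable; first exact: finite_finset.
by move=> k _; rewrite -[Y in measurable Y]setTI; exact: mX.
Qed.

Lemma measurable_off : measurable_fun setT off.
Proof.
apply: (@measurability _ _ O off_space setT off off_rect) => // _ [_ [B mB ->] <-].
rewrite setTI; exact: (measurable_forall mB [pred k | k != q]).
Qed.

Lemma measurable_off_coord k : k != q -> measurable_fun setT (fun z : off_space => z k).
Proof.
move=> kq _ B mB; rewrite setTI; apply: sub_gen_smallest.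
exists (fun i => if i == k then B else setT); first by move=> i; case: ifP.
apply/seteqP; split => [z Bz i iq|z /(_ k kq)]; last by rewrite eqxx.
by case: eqP => // ->.
Qed.

HB.instance Definition _ := isMeasurableFun.Build _ _ _ _ off measurable_off.

(** For fixed [A] both sides are finite measures in [B]. They agree on the rectangles, which are
    stable under intersection and generate the sigma-algebra of [off_space]. *)
Lemma indep_off (A : set R) (B : set off_space) : measurable A -> measurable B ->
  P (X q @^-1` A `&` off @^-1` B) = (P (X q @^-1` A) * P (off @^-1` B))%E.
Proof.
move=> mA mB; have mXA : measurable (X q @^-1` A).
  by rewrite -[Y in measurable Y]setTI; exact: mX.
have PA0 : 0 <= fine (P (X q @^-1` A)) by exact: fine_ge0.
pose m1' : {measure set off_space -> \bar R} := pushforward (mrestr P mXA) off.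
pose m1 := m1' measurable_off.
pose m2' : {measure set off_space -> \bar R} := mscale (NngNum PA0) (pushforward P off).
pose m2 := m2' measurable_off.
suff : m1 B = m2 B.
  rewrite /m1 /m2 /= /pushforward /mrestr /mscale/= setIC => ->.
  by rewrite fineK// fin_num_measure.
apply: (@measure_unique _ R off_space off_rect (fun=> setT) _ _ _ _ m1 m2) => //.
- move=> _ _ [B1 mB1 ->] [B2 mB2 ->]; exists (fun k => B1 k `&` B2 k).
    by move=> k; exact: measurableI.
  by apply/seteqP; split => [z [H1 H2] k kq|z H]; [split; [exact: H1|exact: H2]|split=> k /H[]].
- by move=> _; exists (fun=> setT) => //; apply/seteqP; split.
- by apply/seteqP; split => // z _; exists 0%N.
- move=> _ [C mC ->]; rewrite /m1 /m2 /= /pushforward /mrestr /mscale/= fineK ?fin_num_measure//.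
  (* A rectangle leaves the coordinate [q] free; filling it with [A] or with the full line makes
     mutual independence applicable to the whole family. *)
  pose C1 k := if k == q then A else C k.
  pose C2 k := if k == q then setT else C k.
  have mC1 k : measurable (C1 k) by rewrite /C1; case: ifP.
  have mC2 k : measurable (C2 k) by rewrite /C2; case: ifP.
  transitivity (P [set o | forall k, C1 k (X k o)]).
    congr (P _); apply/seteqP; split => o.
      by move=> [H Ao] k; rewrite /C1; case: eqP => [->//|/eqP]; exact: H.
    move=> H; split; last by have := H q; rewrite /C1 eqxx.
    by move=> k kq; have := H k; rewrite /C1 (negbTE kq).
  rewrite (indX mC1).
  have -> : pushforward P off [set z : off_space | forall k, k != q -> C k (z k)] =
      P [set o | forall k, C2 k (X k o)].
    congr (P _).
    apply/seteqP; split => o.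
      by move=> H k; rewrite /C2; case: eqP => // /eqP; exact: H.
    by move=> H k kq; have := H k; rewrite /C2 (negbTE kq).
  rewrite (indX mC2) (bigD1 q)//= [X in (_ = _ * X)%E](bigD1 q)//=.
  have -> : P [set o | C2 q (X q o)] = 1%E.
    by rewrite /C2 eqxx -[RHS](probability_setT P); congr (P _); apply/seteqP; split.
  rewrite mul1e; congr (_ * _)%E; first by rewrite /C1 eqxx.
  by apply: eq_bigr => k kq; rewrite /C1 /C2 (negbTE kq).
- by move=> _; rewrite /m1 /= /pushforward /mrestr preimage_setT setTI ltey_eq fin_num_measure.
Qed.

Variable s : R.
Hypothesis lawX : forall B, measurable B -> P (X q @^-1` B) = normal_prob 0 s B.

(** By [indep_off] the joint law of [X q] and [off] is the product of the normal law and the law of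
    [off], and Fubini's theorem applies. *)
Lemma indep_expectation (phi : R -> (I -> R) -> R) :
  measurable_fun setT (fun u : measurableTypeR R * off_space => phi u.1 u.2) ->
  P.-integrable setT (fun o => (phi (X q o) (off o))%:E) ->
  (\int[P]_o (phi (X q o) (off o))%:E =
   \int[distribution P off]_z \int[normal_prob 0%R s]_x (phi x z)%:E)%E.
Proof.
move=> mphi iphi.
pose pr (o : O) : measurableTypeR R * off_space := (X q o, off o).
have mpr : measurable_fun setT pr.
  by apply/measurable_fun_pairP; split; [exact: mX|exact: measurable_off].
pose m0 : {measure set (measurableTypeR R * off_space) -> \bar R} := pushforward P pr.
pose m' := m0 mpr.
have mE : forall A, measurable A -> (normal_prob 0 s \x distribution P off)%E A = m' A.
  apply: product_measure_unique => A B mA mB.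
  rewrite /m' /= /pushforward -lawX// /distribution /pushforward -indep_off//.
pose F (u : measurableTypeR R * off_space) := (phi u.1 u.2)%:E.
have mF : measurable_fun setT F by apply/measurable_EFinP.
have iF : (normal_prob 0 s \x distribution P off)%E.-integrable setT F.
  have /integrableP[_ H] := @integrable_pushforward _ _ _ _ _ _ mpr P setT F mF iphi measurableT.
  apply/integrableP; split => //.
  by rewrite (eq_measure_integral m')//; move=> A mA _; exact: mE.
have := integral21_prod_meas1 iF; rewrite /fubini_G /= => ->.
rewrite (eq_measure_integral m'); last by move=> A mA _; exact: mE.
by rewrite integral_pushforward.
Qed.

End IndependentCoordinate.

Lemma probability_bounded_integrable (disp : measure_display) (O : measurableType disp)
    (R : realType) (P : probability O R) (f : O -> R) (C : R) :
  measurable_fun setT f -> (forall o, (`|f o| <= C)%R) ->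
  P.-integrable setT (fun o => (f o)%:E).
Proof.
move=> mf fC; apply: measurable_bounded_integrable => //.
  by rewrite [X in (X < _)%E]probability_setT ltry.
by exists C; split; [exact: num_real|move=> y Cy x _; exact: le_trans (fC x) (ltW Cy)].
Qed.

Section IndependentIBP.
Context (disp : measure_display) (O : measurableType disp) (R : realType).
Context (P : probability O R) (I : finType) (X : I -> O -> R) (q : I) (s C : R).
Local Open Scope ring_scope.
Hypothesis mX : forall i, measurable_fun setT (X i).
Hypothesis lawX : forall B, measurable B -> P (X q @^-1` B) = normal_prob 0 s B.
Hypothesis s0 : 0 < s.

Lemma integrable_gaussian : P.-integrable setT (fun o => (X q o)%:E).
Proof.
apply/integrableP; split; first exact/measurable_EFinP.
have /integrableP[_] := integrable_normal_id s0.
pose m0 : {measure set (measurableTypeR R) -> \bar R} := pushforward P (X q : O -> measurableTypeR R).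
pose m' := m0 (mX q).
rewrite (eq_measure_integral m'); last by move=> A mA _; rewrite /= -lawX.
rewrite ge0_integral_pushforward//.
  exact: mX.
by apply: measurableT_comp => //; exact/measurable_EFinP.
Qed.

Hypothesis indX : mutually_independent P X.
Variables (psi dpsi : R -> (I -> R) -> R).
Hypothesis dpsiE : forall z (x : R), is_derive x 1 (psi ^~ z) (dpsi x z).
Hypothesis cdpsi : forall z, continuous (dpsi ^~ z).
Hypothesis psiC : forall x z, `|psi x z| <= C.
Hypothesis dpsiC : forall x z, `|dpsi x z| <= C.
Hypothesis mpsi : measurable_fun setT
  (fun u : measurableTypeR R * off_space R q => psi u.1 u.2).
Hypothesis mdpsi : measurable_fun setT
  (fun u : measurableTypeR R * off_space R q => dpsi u.1 u.2).

(** Measurability over [off_space] keeps [psi] and [dpsi] from depending on the coordinate [q] of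
    their second argument. So that argument can be frozen, and the one-dimensional formula is
    applied under the integral over it. *)
Lemma indep_gaussian_IBP :
  (\int[P]_o (psi (X q o) (X ^~ o) * X q o)%:E =
   \int[P]_o (s ^+ 2 * dpsi (X q o) (X ^~ o))%:E)%E.
Proof.
have C0 : 0 <= C by apply: le_trans (psiC 0 (fun=> 0)).
have mpr : measurable_fun setT (fun o => (X q o, off X q o) : measurableTypeR R * off_space R q).
  by apply/measurable_fun_pairP; split; [exact: mX|exact: measurable_off].
have mcomp (f : R -> (I -> R) -> R) :
    measurable_fun setT (fun u : measurableTypeR R * off_space R q => f u.1 u.2) ->
    measurable_fun setT (fun o => f (X q o) (off X q o)).
  by move=> mf; exact: (measurableT_comp mf mpr).
rewrite (indep_expectation mX indX lawX (phi := fun x z => psi x z * x)).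
- rewrite (indep_expectation mX indX lawX (phi := fun x z => s ^+ 2 * dpsi x z)).
  + apply: eq_integral => z _.
    rewrite (gaussian_IBP s0 (dpsiE z) (@cdpsi z) (psiC ^~ z) (dpsiC ^~ z)).
    under [RHS]eq_integral do rewrite EFinM.
    rewrite integralZl//.
    apply: (@probability_bounded_integrable _ _ _ _ _ C) => //.
    exact: continuous_measurable_fun (@cdpsi z).
  + by apply: measurable_funM => //; exact: mdpsi.
  + apply: (@probability_bounded_integrable _ _ _ _ _ (s ^+ 2 * C)).
      by apply: measurable_funM => //; exact: mcomp mdpsi.
    by move=> o; rewrite normrM (ger0_norm (sqr_ge0 _)) ler_wpM2l// sqr_ge0.
- by apply: measurable_funM => //; exact: mpsi.
- have Ix := integrableZl measurableT C integrable_gaussian.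
  apply: (le_integrable _ _ _ Ix) => //.
    by apply/measurable_EFinP; apply: measurable_funM => //; exact: mcomp mpsi.
  by move=> o _ /=; rewrite lee_fin !normrM (ger0_norm C0) ler_wpM2r.
Qed.

End IndependentIBP.

(** * Integration by parts for Brownian motion *)

Section BrownianIncrement.
Context {R : realType} (d : nat) (M : \bar R) (mu : probability (wspace R d M) R).
Local Open Scope ring_scope.
Hypothesis hW : brownian_law mu.
Variables (N : nat) (u : nat -> R).
Hypothesis incu : increasing_times M N u.

Let inc (ki : 'I_N * 'I_d) (w : wspace R d M) : R :=
  (w : wpath R d M) (u ki.1.+1) ord0 ki.2 - (w : wpath R d M) (u ki.1) ord0 ki.2.

Lemma measurable_inc ki : measurable_fun setT (inc ki).
Proof. by apply: measurable_funB; exact: measurable_wcoord. Qed.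

Lemma inc_law (q : 'I_N * 'I_d) (B : set R) : u q.1 < u q.1.+1 -> measurable B ->
  mu (inc q @^-1` B) = normal_prob 0 (Num.sqrt (u q.1.+1 - u q.1)) B.
Proof.
by move=> lt mB; apply: hW.2 => //; apply: incu.1 => //; exact: ltnW.
Qed.

Lemma integrable_inc q : mu.-integrable setT (fun w => (inc q w)%:E).
Proof.
(* Grid times may coincide. A degenerate increment vanishes identically and is treated apart, as the
   normal law is given for s < t only. *)
have := incu.2 _ (ltn_ord q.1); rewrite le_eqVlt => /predU1P[E|lt].
  rewrite (_ : (fun w => _) = cst 0%E) ?integrable0//.
  by apply/funext => w; rewrite /inc E subrr.
apply: (@integrable_gaussian _ _ _ _ _ inc q (Num.sqrt (u q.1.+1 - u q.1)) measurable_inc).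
- by move=> B mB; exact: inc_law.
- by rewrite sqrtr_gt0 subr_gt0.
Qed.

(** Here [a i] is the position in the grid of the i-th time, so the value of the path is the sum of
    the increments before that position. *)
Definition path_of_inc n (a : 'I_n -> nat) (z : 'I_N * 'I_d -> R) : 'M[R]_(n, d) :=
  \matrix_(i, j) \sum_(k < N | (k < a i)%N) z (k, j).

Lemma evalmx_inc n (a : 'I_n -> nat) (w : wpath R d M) : u 0%N = 0 ->
  (forall i, (a i <= N)%N) ->
  evalmx (u \o a) w = path_of_inc a (inc ^~ w).
Proof.
move=> u0 aN; apply/matrixP => i j; rewrite !mxE /inc/=.
pose v k := w (u k) ord0 j.
rewrite (eq_bigr (fun k : 'I_N => v k.+1 - v k))//.
rewrite -(big_ord_widen _ (fun k => v k.+1 - v k) (aN i)).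
rewrite -(big_mkord xpredT (fun k => v k.+1 - v k)) telescope_sumr//.
by rewrite /v u0 (wval_start w (lexx 0)) mxE subr0.
Qed.

Section Base.
Variable q : 'I_N * 'I_d.

Definition upd (z : 'I_N * 'I_d -> R) (x : R) k := if k == q then x else z k.

(** The partial derivative of [path_of_inc a] in the increment [q]: only the component [q.2], at
    times after that increment, is affected. *)
Definition updmx n (a : 'I_n -> nat) : 'M[R]_(n, d) :=
  \matrix_(i, j) ((q.2 == j) && (q.1 < a i)%N)%:R.

Lemma path_of_inc_upd n (a : 'I_n -> nat) z x :
  path_of_inc a (upd z x) = path_of_inc a (upd z 0) + x *: updmx a.
Proof.
apply/matrixP => i j; rewrite /path_of_inc /updmx !mxE.
have [qj|qj] := eqVneq q.2 j; last first.
  rewrite /= mulr0 addr0; apply: eq_bigr => k _.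
  by rewrite /upd; case: eqP => // E; rewrite -E eqxx in qj.
have [qa|qa] := ltnP q.1 (a i); last first.
  rewrite mulr0 addr0; apply: eq_bigr => k ka.
  by rewrite /upd; case: eqP => // E; rewrite -E /= leqNgt ka in qa.
rewrite mulr1 (bigD1 q.1)//= [in RHS](bigD1 q.1)//= -qj -surjective_pairing.
rewrite /upd eqxx add0r addrC; congr (_ + _); apply: eq_bigr => k /andP[_ kq].
by case: eqP => // E; rewrite -E eqxx in kq.
Qed.

Lemma path_of_inc_upd_id n (a : 'I_n -> nat) z :
  path_of_inc a z = path_of_inc a (upd z 0) + z q *: updmx a.
Proof.
rewrite -path_of_inc_upd; congr path_of_inc; apply/funext => k.
by rewrite /upd; case: eqP => // ->.
Qed.

Lemma Cb_bounded n k (f : 'M[R]_(n, d) -> R) : Cb k f -> exists2 C, 0 <= C & forall A, `|f A| <= C.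
Proof.
by case: k => [|k] [_ [C HC] _]; exists C => //; apply: le_trans (HC 0).
Qed.

(** With the other increments frozen, both matrices of path values are affine in the increment [q],
    with slopes [updmx a] and [updmx b]. The product rule supplies the derivative, and the factor in
    front is the variance of the increment. *)
Lemma ibp_base n m (f : 'M[R]_(n, d) -> R) (g : 'M[R]_(m, d) -> R)
    (a : 'I_n -> nat) (b : 'I_m -> nat) :
  Cb 1 f -> Cb 1 g -> u 0%N = 0 -> (forall i, (a i <= N)%N) -> (forall i, (b i <= N)%N) ->
  (\int[mu]_w (f (evalmx (u \o a) (w : wpath R d M)) * g (evalmx (u \o b) (w : wpath R d M)) * inc q w)%:E =
   \int[mu]_w ((u q.1.+1 - u q.1) *
     (grad f (updmx a) (evalmx (u \o a) (w : wpath R d M)) * g (evalmx (u \o b) (w : wpath R d M)) +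
      f (evalmx (u \o a) (w : wpath R d M)) * grad g (updmx b) (evalmx (u \o b) (w : wpath R d M))))%:E)%E.
Proof.
move=> Cf Cg u0 aN bN.
have := incu.2 _ (ltn_ord q.1); rewrite le_eqVlt => /predU1P[E|lt].
  by apply: eq_integral => w _; rewrite /inc E !subrr mulr0 mul0r.
(* The coordinate [q] is reset to 0, so that [A z] and [A' z] do not depend on it, as [off_space]
   demands; the increment re-enters as the variable x. *)
pose A z := path_of_inc a (upd z 0); pose A' z := path_of_inc b (upd z 0).
pose B := updmx a; pose B' := updmx b.
pose psi (x : R) z := f (A z + x *: B) * g (A' z + x *: B').
pose dpsi (x : R) z := grad f B (A z + x *: B) * g (A' z + x *: B') +
                 f (A z + x *: B) * grad g B' (A' z + x *: B').
have df (x : R) z : is_derive x 1 (fun x => f (A z + x *: B)) (grad f B (A z + x *: B)).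
  exact: dir_derive_line (Cb1_has_dir_derive B Cf).
have dg (x : R) z : is_derive x 1 (fun x => g (A' z + x *: B')) (grad g B' (A' z + x *: B')).
  exact: dir_derive_line (Cb1_has_dir_derive B' Cg).
have dpsiE z (x : R) : is_derive x 1 (psi ^~ z) (dpsi x z).
  have ? := df x z; have ? := dg x z.
  by apply: is_derive_eq; rewrite /dpsi /GRing.scale/= addrC [g _ * _]mulrC.
have cline p (A0 B0 : 'M[R]_(p, d)) : continuous (fun x : R => A0 + x *: B0).
  move=> x; apply: cvgD; first exact: cvg_cst.
  by apply: cvgZ; [exact: cvg_id|exact: cvg_cst].
have ccomp p (A0 B0 : 'M[R]_(p, d)) (F : 'M[R]_(p, d) -> R) :
    continuous F -> continuous (fun x : R => F (A0 + x *: B0)).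
  by move=> cF x; exact: (cvg_comp _ _ (cline p A0 B0 x) (cF _)).
have [cf _ _] := Cf; have [cg _ _] := Cg.
have cgf := @continuous_grad _ _ _ f B Cf; have cgg := @continuous_grad _ _ _ g B' Cg.
have cdpsi z : continuous (dpsi ^~ z).
  by move=> x; apply: cvgD; apply: cvgM; exact: ccomp.
have [C1 C10 fC] := Cb_bounded Cf; have [C2 C20 gC] := Cb_bounded Cg.
have [D1 D10 dfC] := bounded_grad Cf; have [D2 D20 dgC] := bounded_grad Cg.
pose K1 := D1 * \sum_(p : 'I_n * 'I_d) `|B p.1 p.2|.
pose K2 := D2 * \sum_(p : 'I_m * 'I_d) `|B' p.1 p.2|.
have K10 : 0 <= K1 by rewrite mulr_ge0// sumr_ge0.
have K20 : 0 <= K2 by rewrite mulr_ge0// sumr_ge0.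
(* A single constant has to bound both [psi] and [dpsi]: the first term serves [psi], the bracket
   [dpsi]. *)
pose C := C1 * C2 + (K1 * C2 + C1 * K2).
have psiC x z : `|psi x z| <= C.
  rewrite normrM; apply: (@le_trans _ _ (C1 * C2)); first exact: ler_pM.
  by rewrite lerDl addr_ge0// mulr_ge0.
have dpsiC x z : `|dpsi x z| <= C.
  apply: (@le_trans _ _ (K1 * C2 + C1 * K2)); last by rewrite lerDr mulr_ge0.
  by apply: (le_trans (ler_normD _ _)); rewrite !normrM; apply: lerD; apply: ler_pM.
have mpath p (e : 'I_p -> nat) (F : 'M[R]_(p, d) -> R) : continuous F ->
    measurable_fun setT (fun v : measurableTypeR R * off_space R q =>
      F (path_of_inc e (upd v.2 0) + v.1 *: updmx e)).
  move=> cF; apply: measurable_continuous_mx => // i j.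
  (* Each entry is a finite sum in which the summand [q] is the first component of [v], and every
     other summand is a coordinate visible to [off_space]. *)
  rewrite (_ : (fun v => _) = (fun v : measurableTypeR R * off_space R q =>
      \sum_(k < N) if (k < e i)%N then upd v.2 v.1 (k, j) else 0)); last first.
    by apply/funext => v; rewrite -(path_of_inc_upd e v.2 v.1) /path_of_inc mxE big_mkcond.
  apply: measurable_sum => k; case: (k < e i)%N => //.
  rewrite /upd; case: (eqVneq (k, j) q) => [_|kq]; first exact: measurable_fst.
  exact: (measurableT_comp (measurable_off_coord kq) measurable_snd).
have sig : (Num.sqrt (u q.1.+1 - u q.1)) ^+ 2 = u q.1.+1 - u q.1.
  by rewrite sqr_sqrtr// subr_ge0 ltW.
have s0 : 0 < Num.sqrt (u q.1.+1 - u q.1) by rewrite sqrtr_gt0 subr_gt0.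
have indX : mutually_independent mu inc by exact: hW.1.
have := indep_gaussian_IBP measurable_inc (fun B mB => inc_law lt mB) s0 indX dpsiE cdpsi psiC dpsiC.
rewrite sig => main.
have WE w : evalmx (u \o a) (w : wpath R d M) = A (inc ^~ w) + inc q w *: B.
  by rewrite evalmx_inc// -path_of_inc_upd_id.
have WE' w : evalmx (u \o b) (w : wpath R d M) = A' (inc ^~ w) + inc q w *: B'.
  by rewrite evalmx_inc// -path_of_inc_upd_id.
under eq_integral do rewrite WE WE'.
under [RHS]eq_integral do rewrite WE WE'.
apply: main.
- by apply: measurable_funM; exact: mpath.
- by apply: measurable_funD; apply: measurable_funM; exact: mpath.
Qed.

End Base.
End BrownianIncrement.

(** * From increments to elementary stochastic integrals *)

Section BrownianIBP.
Context {R : realType} (d : nat) (M : \bar R) (mu : probability (wspace R d M) R).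
Local Open Scope ring_scope.
Hypothesis hW : brownian_law mu.
Variables (n m : nat) (f : 'M[R]_(n, d) -> R) (g : 'M[R]_(m, d) -> R).
Hypotheses (Cf : Cb 1 f) (Cg : Cb 1 g).
Variables (s : 'I_n -> R) (r : 'I_m -> R).
Hypotheses (sM : forall i, time_set M (s i)) (rM : forall j, time_set M (r j)).
Implicit Types (Y : wspace R d M -> R) (V : R -> 'rV[R]_d) (w : wpath R d M).

Definition fg w : R := f (evalmx s w) * g (evalmx r w).

Definition Dfg V w : R := grad f (evalmx s V) (evalmx s w) * g (evalmx r w) +
  f (evalmx s w) * grad g (evalmx r V) (evalmx r w).

Lemma gradD p (F : 'M[R]_(p, d) -> R) B B' A : grad F (B + B') A = grad F B A + grad F B' A.
Proof. by rewrite /grad -big_split; apply: eq_bigr => k _; rewrite mxE mulrDl. Qed.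

Lemma gradZ p (F : 'M[R]_(p, d) -> R) c B A : grad F (c *: B) A = c * grad F B A.
Proof. by rewrite /grad mulr_sumr; apply: eq_bigr => k _; rewrite mxE mulrA. Qed.

Lemma DfgD V V' w : Dfg (fun t => V t + V' t) w = Dfg V w + Dfg V' w.
Proof.
have E p (t : 'I_p -> R) : evalmx t (fun t => V t + V' t) = evalmx t V + evalmx t V'.
  by apply/matrixP => i j; rewrite !mxE.
by rewrite /Dfg !E !gradD; ring.
Qed.

Lemma DfgZ c V w : Dfg (fun t => c *: V t) w = c * Dfg V w.
Proof.
have E p (t : 'I_p -> R) : evalmx t (fun t => c *: V t) = c *: evalmx t V.
  by apply/matrixP => i j; rewrite !mxE.
by rewrite /Dfg !E !gradZ; ring.
Qed.

Lemma measurable_path_fun p (F : 'M[R]_(p, d) -> R) (t : 'I_p -> R) : continuous F ->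
  measurable_fun setT (fun w : wspace R d M => F (evalmx t (w : wpath R d M))).
Proof.
move=> cF; apply: measurable_continuous_mx => // i j.
under eq_fun do rewrite mxE.
exact: measurable_wcoord.
Qed.

Lemma measurable_fg : measurable_fun setT (fg : wspace R d M -> R).
Proof.
have [cf _ _] := Cf; have [cg _ _] := Cg.
by apply: measurable_funM; exact: measurable_path_fun.
Qed.

Lemma measurable_Dfg V : measurable_fun setT (Dfg V : wspace R d M -> R).
Proof.
have [cf _ _] := Cf; have [cg _ _] := Cg.
apply: measurable_funD; apply: measurable_funM; apply: measurable_path_fun => //.
- exact: continuous_grad.
- exact: continuous_grad.
Qed.

Lemma bounded_fg : exists2 C, 0 <= C & forall w, `|fg w| <= C.
Proof.
have [C1 C10 fC] := Cb_bounded Cf; have [C2 C20 gC] := Cb_bounded Cg.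
exists (C1 * C2); first exact: mulr_ge0.
by move=> w; rewrite normrM; exact: ler_pM.
Qed.

(** The bound is uniform in the path and sees [V] only at finitely many times, so convergence of [V]
    at these times gives uniform convergence of [Dfg V]. *)
Lemma bounded_Dfg : exists2 C, 0 <= C & forall V w, `|Dfg V w| <=
  C * (\sum_(p : 'I_n * 'I_d) `|V (s p.1) ord0 p.2| + \sum_(p : 'I_m * 'I_d) `|V (r p.1) ord0 p.2|).
Proof.
have [C1 C10 fC] := Cb_bounded Cf; have [C2 C20 gC] := Cb_bounded Cg.
have [D1 D10 dfC] := bounded_grad Cf; have [D2 D20 dgC] := bounded_grad Cg.
exists (D1 * C2 + D2 * C1); first by rewrite addr_ge0// mulr_ge0.
move=> V w; set S1 := \sum_(p : 'I_n * 'I_d) _; set S2 := \sum_(p : 'I_m * 'I_d) _.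
have S10 : 0 <= S1 by exact: sumr_ge0.
have S20 : 0 <= S2 by exact: sumr_ge0.
have b1 : `|grad f (evalmx s V) (evalmx s w)| <= D1 * S1.
  apply: (le_trans (dfC _ _)); rewrite ler_wpM2l// /S1.
  by apply: ler_sum => p _; rewrite mxE.
have b2 : `|grad g (evalmx r V) (evalmx r w)| <= D2 * S2.
  apply: (le_trans (dgC _ _)); rewrite ler_wpM2l// /S2.
  by apply: ler_sum => p _; rewrite mxE.
apply: (@le_trans _ _ (D1 * S1 * C2 + C1 * (D2 * S2))).
  by apply: (le_trans (ler_normD _ _)); rewrite !normrM; apply: lerD; apply: ler_pM.
rewrite -subr_ge0.
have -> : (D1 * C2 + D2 * C1) * (S1 + S2) - (D1 * S1 * C2 + C1 * (D2 * S2)) =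
  D1 * C2 * S2 + D2 * C1 * S1 by ring.
by rewrite addr_ge0// !mulr_ge0.
Qed.

Lemma integrable_Dfg V : mu.-integrable setT (fun w => (Dfg V w)%:E).
Proof.
have [C C0 HC] := bounded_Dfg.
exact: (@probability_bounded_integrable _ (wspace R d M) _ mu (Dfg V) _ (measurable_Dfg V) (HC V)).
Qed.

Lemma integrable_fgM Y : mu.-integrable setT (fun w => (Y w)%:E) ->
  mu.-integrable setT (fun w => (fg w * Y w)%:E).
Proof.
move=> iY; have [C C0 HC] := bounded_fg.
have mY : measurable_fun setT Y by apply/measurable_EFinP; exact: measurable_int iY.
have CY := integrableZl measurableT C iY.
apply: (le_integrable _ _ _ CY) => //.
  by apply/measurable_EFinP; apply: measurable_funM => //; exact: measurable_fg.
by move=> w _ /=; rewrite lee_fin normrM [leRHS]normrM (ger0_norm C0) ler_wpM2r//; exact: HC.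
Qed.

(* For [Y] linear in the Brownian path, [V t] is the covariance of [Y] and the
   path at time [t]. *)
Definition ibp Y V := mu.-integrable setT (fun w => (Y w)%:E) /\
  (\int[mu]_w (fg w * Y w)%:E = \int[mu]_w (Dfg V w)%:E)%E.

Lemma ibp0 : ibp (fun=> 0) (fun=> 0).
Proof.
split; first exact: integrable0.
rewrite !integral0_eq// => w _.
  have -> : Dfg (fun=> 0) w = 0 * Dfg (fun=> 0) w by rewrite -DfgZ scale0r.
  by rewrite mul0r.
by rewrite mulr0.
Qed.

Lemma ibpD Y V Y' V' : ibp Y V -> ibp Y' V' ->
  ibp (fun w => Y w + Y' w) (fun t => V t + V' t).
Proof.
move=> [iY E] [iY' E']; split.
  by under eq_fun do rewrite EFinD; exact: integrableD.
under eq_integral do rewrite mulrDr EFinD.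
under [RHS]eq_integral do rewrite DfgD EFinD.
rewrite !integralD//= ?E ?E'//; try exact: integrable_Dfg; exact: integrable_fgM.
Qed.

Lemma ibpZ c Y V : ibp Y V -> ibp (fun w => c * Y w) (fun t => c *: V t).
Proof.
move=> [iY E]; split.
  by under eq_fun do rewrite EFinM; exact: integrableZl.
under eq_integral do rewrite mulrCA EFinM.
under [RHS]eq_integral do rewrite DfgZ EFinM.
rewrite !integralZl//= ?E//; first exact: integrable_Dfg; exact: integrable_fgM.
Qed.

Lemma ibp_sum (I : Type) (l : seq I) (Y : I -> wspace R d M -> R) (V : I -> R -> 'rV[R]_d) :
  (forall i, ibp (Y i) (V i)) ->
  ibp (fun w => \sum_(i <- l) Y i w) (fun t => \sum_(i <- l) V i t).
Proof.
move=> H; elim: l => [|i l ih].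
  rewrite (_ : (fun w => _) = fun=> 0); last by apply/funext => w; rewrite big_nil.
  rewrite (_ : (fun t => _) = fun=> 0); last by apply/funext => t; rewrite big_nil.
  exact: ibp0.
rewrite (_ : (fun w => _) = fun w => Y i w + \sum_(i <- l) Y i w); last first.
  by apply/funext => w; rewrite big_cons.
rewrite (_ : (fun t => _) = fun t => V i t + \sum_(i <- l) V i t); last first.
  by apply/funext => t; rewrite big_cons.
exact: ibpD.
Qed.

Lemma ibp_eq Y V V' : (forall i, V (s i) = V' (s i)) -> (forall j, V (r j) = V' (r j)) ->
  ibp Y V -> ibp Y V'.
Proof.
move=> sE rE [iY E]; split => //; rewrite E; apply: eq_integral => w _.
have -> // : Dfg V w = Dfg V' w.
rewrite /Dfg (_ : evalmx s V = evalmx s V'); last by apply/matrixP => i j; rewrite !mxE sE.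
by rewrite (_ : evalmx r V = evalmx r V')//; apply/matrixP => i j; rewrite !mxE rE.
Qed.

Lemma partition_exists (l : seq R) : (forall x, x \in l -> time_set M x) -> 0 \in l ->
  exists (N : nat) (u : nat -> R), [/\ increasing_times M N u, u 0%N = 0 &
    forall x, x \in l -> exists2 k, (k <= N)%N & x = u k].
Proof.
move=> lM l0; pose l' := sort <=%R l.
have ml' x : (x \in l') = (x \in l) by rewrite mem_sort.
have sl' : sorted <=%R l' by apply: sort_sorted; exact: le_total.
have szl' : (0 < size l')%N by case: l' ml' {sl'} => // /(_ 0); rewrite l0.
exists (size l').-1, (nth 0 l'); split.
- split => k kN.
    by apply: lM; rewrite -ml' mem_nth// -(prednK szl') ltnS.
  apply: (sorted_leq_nth le_trans lexx 0 sl'); rewrite ?inE//.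
  + by rewrite -(prednK szl') ltnS ltnW.
  + by rewrite -(prednK szl') ltnS.
- apply/eqP; rewrite eq_le; apply/andP; split.
    rewrite -{2}(nth_index 0 (_ : 0 \in l')) ?ml'//.
    apply: (sorted_leq_nth le_trans lexx 0 sl'); rewrite ?inE//.
    by rewrite index_mem ml'.
  have : nth 0 l' 0 \in l by rewrite -ml' mem_nth.
  by move=> /lM[].
- move=> x; rewrite -ml' => xl'; exists (index x l'); last by rewrite nth_index.
  by rewrite -ltnS prednK// index_mem.
Qed.

(** The covariance of W_tau and W_t, in the same coordinate, is min (tau, t). On a grid containing
    0, [tau] and all times of [f] and [g], W_tau is a sum of increments, to each of which [ibp_base]
    applies. *)
Lemma ibp_coord (tau : R) (c : 'I_d) : time_set M tau ->
  ibp (fun w => (w : wpath R d M) tau ord0 c) (fun t => Num.min tau t *: delta_mx ord0 c).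
Proof.
move=> tM.
have M0 : time_set M 0 by split => //; case: tM => t0; apply: le_trans; rewrite lee_fin.
pose l := [:: 0; tau] ++ [seq s i | i <- enum 'I_n] ++ [seq r i | i <- enum 'I_m].
have lM x : x \in l -> time_set M x.
  rewrite !mem_cat !inE => /orP[/orP[|]/eqP->//|/orP[|]/mapP[i _ ->]//].
have l0 : 0 \in l by rewrite inE eqxx.
have [N [u [incu u0 ul]]] := partition_exists lM l0.
have [kt ktN tE] : exists2 k, (k <= N)%N & tau = u k by apply: ul; rewrite !inE eqxx orbT.
have /choice[a Ha] i : exists k, (k <= N)%N /\ s i = u k.
  have [|k kN sE] := ul (s i); last by exists k.
  by rewrite !mem_cat map_f ?orbT// mem_enum.
have /choice[b Hb] i : exists k, (k <= N)%N /\ r i = u k.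
  have [|k kN sE] := ul (r i); last by exists k.
  by rewrite !mem_cat map_f ?orbT// mem_enum.
have und i j : (i <= j)%N -> (j <= N)%N -> u i <= u j.
  elim: j => [|j ih]; first by rewrite leqn0 => /eqP ->.
  rewrite leq_eqVlt => /predU1P[->//|ij jN].
  by apply: (le_trans (ih ij (ltnW jN))); exact: incu.2.
have base (k : 'I_N) : ibp (fun w => (w : wpath R d M) (u k.+1) ord0 c - (w : wpath R d M) (u k) ord0 c)
    (fun t => (Num.min (u k.+1) t - Num.min (u k) t) *: delta_mx ord0 c).
  split; first exact: (integrable_inc hW incu (k, c)).
  have sE : s = u \o a by apply/funext => i; rewrite /= -(Ha i).2.
  have rE : r = u \o b by apply/funext => i; rewrite /= -(Hb i).2.
  rewrite /fg sE rE (ibp_base hW incu (k, c) Cf Cg u0 (fun i => (Ha i).1) (fun i => (Hb i).1)).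
  apply: eq_integral => w _; congr EFin.
  (* At a grid time the difference of minima is the full length of the cell [k] if the time lies
     beyond it, and 0 otherwise. *)
  have E p (e : 'I_p -> nat) : (forall i, (e i <= N)%N) ->
      evalmx (u \o e) (fun t => (Num.min (u k.+1) t - Num.min (u k) t) *: delta_mx ord0 c) =
      (u k.+1 - u k) *: updmx (k, c) e.
    move=> eN; apply/matrixP => i j; rewrite !mxE eqxx/= [j == c]eq_sym.
    case: eqP => [_|_]; rewrite ?mulr0//= mulr1.
    have [ke|ke] := ltnP k (e i).
      by rewrite mulr1 !min_l// und// ltnW.
    rewrite mulr0 !min_r ?subrr// und//.
      exact: ltnW.
    by rewrite leqW.
  rewrite /Dfg sE rE !E; [|by move=> i; exact: (Hb i).1|by move=> i; exact: (Ha i).1].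
  by rewrite !gradZ; ring.
have {}base (k : nat) : (k <= N)%N ->
    ibp (fun w => (w : wpath R d M) (u k) ord0 c) (fun t => (Num.min (u k) t - Num.min 0 t) *: delta_mx ord0 c).
  elim: k => [_|k ih kN].
    rewrite u0; rewrite (_ : (fun w => _) = fun=> 0); last first.
      by apply/funext => w; rewrite (wval_start (w : wpath R d M) (lexx 0)) mxE.
    rewrite (_ : (fun t => _) = fun=> 0); last by apply/funext => t; rewrite subrr scale0r.
    exact: ibp0.
  have := ibpD (ih (ltnW kN)) (base (Ordinal kN)).
  rewrite (_ : (fun w => _) = fun w => (w : wpath R d M) (u k.+1) ord0 c); last first.
    by apply/funext => w /=; rewrite addrC subrK.
  rewrite (_ : (fun t => _) = fun t => (Num.min (u k.+1) t - Num.min 0 t) *: delta_mx ord0 c)//.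
  by apply/funext => t /=; rewrite -scalerDl; congr (_ *: _); ring.
(* The telescoping sum leaves the term [Num.min 0 t], which vanishes at the nonnegative times that
   matter. *)
rewrite tE; apply: ibp_eq (base kt ktN) => i.
  by case: (sM i) => s0 _; rewrite (min_l s0) subr0.
by case: (rM i) => r0 _; rewrite (min_l r0) subr0.
Qed.

(* The primitive of [step_fun p], for nonnegative times. *)
Definition step_path (p : step R d) (t : R) : 'rV[R]_d :=
  \sum_(k < step_size p) (Num.min (step_time p k.+1) t - Num.min (step_time p k) t) *: step_coef p k.

Lemma ibp_step (p : step R d) : increasing_times M (step_size p) (step_time p) ->
  ibp (fun w => step_integral p (w : wpath R d M)) (step_path p).
Proof.
move=> incp.
rewrite /step_integral /step_path; apply: ibp_sum => k.
have tM1 : time_set M (step_time p k.+1) by exact: incp.1.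
have tM0 : time_set M (step_time p k) by apply: incp.1; exact: ltnW.
have := ibp_sum (index_enum 'I_d) (fun j => ibpZ (step_coef p k ord0 j)
  (ibpD (ibp_coord j tM1) (ibpZ (-1) (ibp_coord j tM0)))).
rewrite (_ : (fun w => _) = (fun w : wspace R d M =>
    dotv (step_coef p k) ((w : wpath R d M) (step_time p k.+1) - (w : wpath R d M) (step_time p k)))); last first.
  by apply/funext => w; rewrite /dotv; apply: eq_bigr => j _; rewrite !mxE mulN1r.
rewrite (_ : (fun t => _) = fun t =>
    (Num.min (step_time p k.+1) t - Num.min (step_time p k) t) *: step_coef p k)//.
apply/funext => t; apply/rowP => j; rewrite summxE (bigD1 j)//= big1 ?addr0.
  by rewrite !mxE !eqxx/=; ring.
by move=> i ij; rewrite !mxE eqxx/= eq_sym (negbTE ij) !mulr0 addr0 mulr0.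
Qed.

End BrownianIBP.

(** * Primitives of step functions close to the derivative of [h] *)

Section StepApproximation.
Context {R : realType} (d : nat) (M : \bar R).
Local Open Scope ring_scope.
Notation leb := (@lebesgue_measure R).

(** The sides differ by (|y| - delta)^2 / delta + |y|. Integrated with a suitable [delta], the
    inequality turns smallness in L^2 into smallness in L^1 over a set of finite measure. *)
Lemma abs_le_sq (delta y : R) : 0 < delta -> `|y| <= delta + delta^-1 * y ^+ 2.
Proof.
move=> d0; rewrite -(real_normK (num_real y)).
have -> : delta + delta^-1 * `|y| ^+ 2 = `|y| + (delta^-1 * (`|y| - delta) ^+ 2 + `|y|).
  by field; rewrite gt_eqF.
by rewrite lerDl addr_ge0// mulr_ge0 ?sqr_ge0// invr_ge0 ltW.
Qed.

Lemma step_fun_coord (p : step R d) x j : step_fun p x ord0 j =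
  \sum_(k < step_size p) step_coef p k ord0 j * \1_`](step_time p k), (step_time p k.+1)] x.
Proof. by rewrite /step_fun summxE; apply: eq_bigr => k _; rewrite mxE mulrC. Qed.

Lemma measurable_step_coord (p : step R d) j :
  measurable_fun setT (fun x => step_fun p x ord0 j).
Proof.
under eq_fun do rewrite step_fun_coord.
by apply: measurable_sum => k; exact: measurable_funM.
Qed.

Lemma integrable_step_term (p : step R d) j (k : 'I_(step_size p)) (D : set (measurableTypeR R)) :
  measurable D -> leb.-integrable D
    (fun x => (step_coef p k ord0 j * \1_`](step_time p k), (step_time p k.+1)] x)%:E).
Proof.
move=> mD; apply: (integrableS measurableT) => //.
under eq_fun do rewrite EFinM.
apply: integrableZl => //; exact: integrable_indic_itv.
Qed.

Lemma integrable_step (p : step R d) j (D : set (measurableTypeR R)) :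
  measurable D -> leb.-integrable D (fun x => (step_fun p x ord0 j)%:E).
Proof.
move=> mD; under eq_fun do rewrite step_fun_coord -sumEFin.
by apply: integrable_sum => // k _; exact: integrable_step_term.
Qed.

Lemma integral_step (a : \bar R) (p : step R d) j s : 0 <= s ->
  increasing_times a (step_size p) (step_time p) ->
  (\int[leb]_(x in `]0%R, s]) (step_fun p x ord0 j)%:E = (step_path p s ord0 j)%:E)%E.
Proof.
move=> s0 incp.
under eq_integral do rewrite step_fun_coord -sumEFin.
rewrite integral_sum//; last by move=> k; exact: integrable_step_term.
rewrite /step_path summxE -sumEFin; apply: eq_bigr => k _.
have tk := incp.2 _ (ltn_ord k).
have tk0 : 0 <= step_time p k by have [] := incp.1 k (ltnW (ltn_ord k)).
under eq_integral do rewrite EFinM.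
rewrite integralZl//; last by apply: (integrableS measurableT) => //; exact: integrable_indic_itv.
rewrite integral_indic// mxE mulrC EFinM; congr (_ * _)%E.
rewrite (_ : _ `&` _ = `]step_time p k, Num.min (step_time p k.+1) s]%classic); last first.
  apply/seteqP; split => x /=; rewrite !in_itv/= le_min.
    by move=> [/andP[-> ->] /andP[_ ->]].
  by move=> /and3P[tx -> ->]; rewrite tx (le_lt_trans tk0 tx).
rewrite /= lebesgue_measure_itv /= lte_fin.
have [ts|ts] := ltP s (step_time p k).
  rewrite !min_r ?subrr ?(ltW ts)// ?(le_trans (ltW ts))//.
  by rewrite ifF//; apply/negbTE; rewrite -leNgt ltW.
case: ifPn => // H.
congr EFin; apply/eqP; rewrite eq_sym subr_eq0 eq_le -leNgt in H *; rewrite H /=.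
by rewrite le_min tk.
Qed.

(** Both values are integrals over ]0, s], of the step function and of the density [f], so
    [abs_le_sq] bounds their difference by the L^2 distance. That distance is stated with
    [derive1 h]; the exchange for [f] takes place inside a lower integral. *)
Lemma step_path_dist (h : wpath R d M) (f : R -> 'rV[R]_d) (a : \bar R) (p : step R d) (s delta : R) j :
  (forall j, measurable_fun setT (fun t => f t ord0 j)) ->
  (forall a, time_set M a -> forall j,
      leb.-integrable `]0, a] (fun t => (f t ord0 j)%:E) /\
      ((h a ord0 j)%:E = \int[leb]_(t in `]0%R, a]) (f t ord0 j)%:E)%E) ->
  {ae leb, forall t, open_time_set M t -> derive1 h t = f t} ->
  (a <= M)%E -> 0 <= s -> (s%:E <= a)%E -> increasing_times a (step_size p) (step_time p) ->
  0 < delta ->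
  (`|step_path p s ord0 j - h s ord0 j|%:E <= (delta * s)%:E +
    delta^-1%:E * \int[leb]_(x in open_time_set a) (sqnormv (step_fun p x - derive1 h x))%:E)%E.
Proof.
move=> mf fi hf aM s0 sa incp d0.
have sM : time_set M s by split => //; exact: le_trans sa aM.
have [fij hE] := fi s sM j.
have isj := integrable_step p j (measurable_itv `]0, s]).
have E : ((step_path p s ord0 j - h s ord0 j)%:E =
    \int[leb]_(x in `]0%R, s]) (step_fun p x ord0 j - f x ord0 j)%:E)%E.
  rewrite EFinB hE -(integral_step j s0 incp).
  by under [RHS]eq_integral do rewrite EFinB; rewrite integralB.
have mdiff : measurable_fun setT (fun x => step_fun p x ord0 j - f x ord0 j).
  by apply: measurable_funB => //; exact: measurable_step_coord.
rewrite -abse_EFin E; apply: (le_trans (le_abse_integral _ _ _)) => //.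
  by apply/measurable_EFinP; exact: measurable_funTS.
apply: (@le_trans _ _ (\int[leb]_(x in `]0%R, s]) (delta%:E +
    delta^-1%:E * ((step_fun p x ord0 j - f x ord0 j) ^+ 2)%:E))%E).
  apply: ge0_le_integral => //=.
  - by apply/measurable_EFinP; apply: measurableT_comp => //; exact: measurable_funTS.
  - apply: emeasurable_funD => //; apply: emeasurable_funM => //.
    by apply/measurable_EFinP; apply: measurable_funX; exact: measurable_funTS.
  - by move=> x _; rewrite -EFinM -EFinD lee_fin; exact: abs_le_sq.
have msq : measurable_fun `]0, s] (fun x => ((step_fun p x ord0 j - f x ord0 j) ^+ 2)%:E).
  by apply/measurable_EFinP; apply: measurable_funX; exact: measurable_funTS.
rewrite ge0_integralD//=; last 3 first.
- by move=> x _; rewrite lee_fin ltW.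
- by move=> x _; rewrite -EFinM lee_fin mulr_ge0 ?invr_ge0 ?sqr_ge0// ltW.
- exact: emeasurable_funM.
rewrite integral_cst//= lebesgue_measure_itv/= ge0_integralZl//; last 2 first.
- by move=> x _; rewrite lee_fin sqr_ge0.
- by rewrite lee_fin invr_ge0 ltW.
apply: leeD.
  rewrite lte_fin; case: ifPn => [s0'|]; first by rewrite oppr0 adde0 EFinM.
  by rewrite mule0 lee_fin mulr_ge0// ltW.
rewrite lee_pmul2l// ?lte_fin ?invr_gt0//.
have [N [mN N0 NE]] := hf.
rewrite [leRHS]integral_mkcond.
(* The point [s] is removed along with the exceptional set of [f], because [s] may be the endpoint
   of the open interval (0, a). *)
apply: (@ge0_le_integral_ae _ _ _ leb _ (N `|` [set s])) => //.
- by apply: measurableU => //; exact: measurable_set1.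
- by rewrite measureU0 //; exact: lebesgue_measure_set1.
- by move=> x _; rewrite lee_fin sqr_ge0.
- by move=> x; rewrite patchE; case: ifP => // _; rewrite lee_fin sqnormv_ge0.
move=> x /=; rewrite in_itv/= => /andP[x0 xs] /not_orP[Nx /eqP xns].
have xs' : x < s by rewrite lt_neqAle xns.
have ax : open_time_set a x by split => //; apply: lt_le_trans sa; rewrite lte_fin.
have Mx : open_time_set M x by split => //; apply: lt_le_trans aM; case: ax.
have -> : f x = derive1 h x.
  by apply/esym; apply: contrapT => H; apply: Nx; apply: NE => /= /(_ Mx).
rewrite patchE ifT; last by rewrite inE.
rewrite lee_fin /sqnormv /dotv (bigD1 j)//= !mxE -expr2 lerDl.
by apply: sumr_ge0 => i _; rewrite -expr2 sqr_ge0.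
Qed.

End StepApproximation.

Lemma cvge0_near_le {R : realType} (u : nat -> \bar R) (e : R) :
  u @ \oo --> 0 -> (0 < e)%R -> \forall k \near \oo, u k <= e%:E.
Proof.
move=> cu e0; apply: (cu [set x | x <= e%:E]).
rewrite /nbhs /= /ereal_nbhs /=.
by apply: filterS (lt_nbhsl e0) => r /= /ltW; rewrite lee_fin.
Qed.

(** * Passage to the limit for the Wiener integral *)

Section WienerIBP.
Context {R : realType} (d : nat) (M : \bar R) (mu : probability (wspace R d M) R).
Local Open Scope ring_scope.
Notation leb := (@lebesgue_measure R).
Hypothesis hW : brownian_law mu.
Variables (n m : nat) (f : 'M[R]_(n, d) -> R) (g : 'M[R]_(m, d) -> R).
Hypotheses (Cf : Cb 1 f) (Cg : Cb 1 g).
Variables (s : 'I_n -> R) (r : 'I_m -> R) (a : \bar R).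
Hypotheses (sa : forall i, time_set a (s i)) (ra : forall j, time_set a (r j)).
Hypothesis aM : (a <= M)%E.
Variables (h : wpath R d M) (hAC : abs_continuous M h).

Lemma wiener_ibp (J : wspace R d M -> R) :
  is_wiener_integral mu a (derive1 h) J -> ibp mu f g s r J h.
Proof.
move=> [mJ [p [incp cvD cve]]].
have aMt t : time_set a t -> time_set M t.
  by move=> [t0 ta]; split => //; exact: le_trans ta aM.
have sM i := aMt _ (sa i); have rM j := aMt _ (ra j).
have incpM k : increasing_times M (step_size (p k)) (step_time (p k)).
  by have [H1 H2] := incp k; split => // i ik; apply/aMt/H1.
have [F [mF FE hF]] := wpath_density hAC.
pose I k (w : wspace R d M) := step_integral (p k) (w : wpath R d M).
pose V k := step_path (p k).
have ibpk k : ibp mu f g s r (I k) (V k) by exact: ibp_step.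
have iI k : mu.-integrable setT (fun w => (I k w)%:E) by have [] := ibpk k.
have mI k : measurable_fun setT (I k) by apply/measurable_EFinP; exact: measurable_int (iI k).
pose er k := (\int[mu]_w ((I k w - J w) ^+ 2)%:E)%E.
pose D k := (\int[leb]_(x in open_time_set a) (sqnormv (step_fun (p k) x - derive1 h x)%R)%:E)%E.
have dist (delta : R) k : 0 < delta ->
    (\int[mu]_w `|I k w - J w|%:E <= delta%:E + delta^-1%:E * er k)%E.
  move=> d0; have di0 : 0 <= delta^-1 by rewrite invr_ge0 ltW.
  have msq : measurable_fun setT (fun w => ((I k w - J w) ^+ 2)%:E).
    by apply/measurable_EFinP; apply: measurable_funX; exact: measurable_funB.
  apply: (@le_trans _ _ (\int[mu]_w (delta%:E + delta^-1%:E * ((I k w - J w) ^+ 2)%:E))%E).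
    apply: ge0_le_integral => //=.
    - by apply/measurable_EFinP; apply: measurableT_comp => //; exact: measurable_funB.
    - by apply: emeasurable_funD => //; exact: emeasurable_funM.
    - by move=> w _; rewrite -EFinM -EFinD lee_fin; exact: abs_le_sq.
  rewrite ge0_integralD//=.
  - rewrite integral_cst//= probability_setT mule1 ge0_integralZl//.
    by move=> w _; rewrite lee_fin sqr_ge0.
  - by move=> w _; rewrite lee_fin ltW.
  - by move=> w _; rewrite -EFinM lee_fin mulr_ge0 ?sqr_ge0.
  - exact: emeasurable_funM.
have near_er (e : R) : 0 < e -> \forall k \near \oo, (er k <= e%:E)%E.
  by move=> e0; exact: (cvge0_near_le cve e0).
have near_D (e : R) : 0 < e -> \forall k \near \oo, (D k <= e%:E)%E.
  by move=> e0; exact: (cvge0_near_le cvD e0).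
have iIJ k : (er k < +oo)%E -> mu.-integrable setT (fun w => (I k w - J w)%:E).
  move=> erk; apply/integrableP; split.
    by apply/measurable_EFinP; exact: measurable_funB.
  apply: (le_lt_trans (dist 1 k ltr01)).
  by rewrite invr1 mul1e lte_add_pinfty// ltry.
(* One index with finite error is enough: the elementary integral and its distance to [J] are both
   integrable. *)
have iJ : mu.-integrable setT (fun w => (J w)%:E).
  have [k _ /(_ k (leqnn k)) ek] := near_er 1 ltr01.
  have ekoo : (er k < +oo)%E by apply: le_lt_trans ek _; rewrite ltry.
  have := integrableB measurableT (iI k) (iIJ k ekoo).
  by congr (is_true (_.-integrable _ _)); apply/funext => w /=; congr EFin; ring.
split => //.
have iE1 := integrable_fgM Cf Cg s r iJ.
have iE2 := integrable_Dfg mu Cf Cg s r h.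
have [C C0 HC] := bounded_fg M Cf Cg s r.
have [C' C'0 HC'] := bounded_Dfg M Cf Cg s r.
(* At a time t the estimate of [step_path_dist] will be delta t + delta, at most (t + 1) (delta +
   delta); [B] sums the factors t + 1 over all entries at the times of [f] and [g]. *)
pose B : R := \sum_(q : 'I_n * 'I_d) (s q.1 + 1) + \sum_(q : 'I_m * 'I_d) (r q.1 + 1).
have s0 i : 0 <= s i by case: (sa i).
have r0 j : 0 <= r j by case: (ra j).
have B0 : 0 <= B by rewrite addr_ge0// sumr_ge0// => q _; rewrite addr_ge0.
(* Both squared errors are taken below delta^2, so that delta + delta^-1 delta^2 is twice
   [delta]. *)
have key (delta : R) : 0 < delta ->
   (`|\int[mu]_w (fg f g s r w * J w)%:E - \int[mu]_w (Dfg f g s r h w)%:E| <=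
     ((C + C' * B) * (delta + delta))%:E)%E.
  move=> d0; have dd0 : 0 < delta ^+ 2 by rewrite exprn_gt0.
  have [k _ /(_ k (leqnn k)) [ek Dk]] : \forall k \near \oo,
     (er k <= (delta ^+ 2)%:E)%E /\ (D k <= (delta ^+ 2)%:E)%E.
    by apply: filterS2 (near_er _ dd0) (near_D _ dd0).
  have dE : (delta%:E + delta^-1%:E * (delta ^+ 2)%:E = (delta + delta)%:E :> \bar R)%E.
    by rewrite -EFinM -EFinD expr2 mulrA mulVf ?mul1r// gt_eqF.
  have ekoo : (er k < +oo)%E by apply: le_lt_trans ek _; rewrite ltry.
  have [iIk Ek] := ibpk k.
  have iE3 := integrable_fgM Cf Cg s r iIk.
  have iE4 := integrable_Dfg mu Cf Cg s r (V k).
  have b1 : (`|\int[mu]_w (fg f g s r w * I k w)%:E - \int[mu]_w (fg f g s r w * J w)%:E| <=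
      (C * (delta + delta))%:E)%E.
    rewrite -integralB//.
    have iB := integrableB measurableT iE3 iE1.
    apply: (le_trans (le_abse_integral _ _ (measurable_int _ iB))) => //.
    apply: (@le_trans _ _ (\int[mu]_w (C%:E * `|I k w - J w|%:E))%E).
      apply: ge0_le_integral => //=.
      - apply/measurable_EFinP; apply: measurableT_comp => //; apply/measurable_EFinP.
        exact: (measurable_int mu iB).
      - apply: emeasurable_funM => //; apply/measurable_EFinP; apply: measurableT_comp => //.
        exact: measurable_funB.
      - by move=> w _; rewrite -EFinM lee_fin -mulrBr normrM ler_wpM2r.
    rewrite ge0_integralZl//; last first.
    - by apply/measurable_EFinP; apply: measurableT_comp => //; exact: measurable_funB.
    rewrite EFinM lee_wpmul2l//; apply: (le_trans (dist delta k d0)).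
    by rewrite -dE leeD2l// lee_pmul2l// lte_fin invr_gt0.
  have b2 : (`|\int[mu]_w (Dfg f g s r (V k) w)%:E - \int[mu]_w (Dfg f g s r h w)%:E| <=
      (C' * B * (delta + delta))%:E)%E.
    rewrite -integralB//.
    have iB := integrableB measurableT iE4 iE2.
    apply: (le_trans (le_abse_integral _ _ (measurable_int _ iB))) => //.
    have ptw t j : time_set a t -> `|V k t ord0 j - h t ord0 j| <= (t + 1) * (delta + delta).
      move=> [t0 ta]; rewrite -lee_fin.
      have := step_path_dist j mF FE hF aM t0 ta (incp k) d0.
      move=> /le_trans; apply.
      apply: (@le_trans _ _ ((delta * t)%:E + delta%:E)%E).
        rewrite leeD2l//; apply: (@le_trans _ _ (delta^-1%:E * (delta ^+ 2)%:E)%E).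
          by rewrite lee_pmul2l// lte_fin invr_gt0.
        by rewrite -EFinM expr2 mulrA mulVf ?mul1r// gt_eqF.
      rewrite -EFinD lee_fin -subr_ge0.
      have -> : (t + 1) * (delta + delta) - (delta * t + delta) = delta * t + delta by ring.
      by rewrite addr_ge0 ?mulr_ge0// ltW.
    apply: (@le_trans _ _ (\int[mu]_w (C' * B * (delta + delta))%:E)%E).
      apply: ge0_le_integral => //=.
      - apply/measurable_EFinP; apply: measurableT_comp => //; apply/measurable_EFinP.
        exact: (measurable_int mu iB).
      - move=> w _; rewrite lee_fin.
        have -> : Dfg f g s r (V k) w - Dfg f g s r h w =
            Dfg f g s r (fun t => V k t + (-1) *: h t) w by rewrite DfgD DfgZ mulN1r.
        apply: (le_trans (HC' _ _)); rewrite -mulrA ler_wpM2l// mulrDl !mulr_suml.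
        by apply: lerD; apply: ler_sum => q _; rewrite !mxE mulN1r; apply: ptw.
    by rewrite integral_cst//= probability_setT mule1.
  rewrite -Ek in b2.
  move: b1 b2.
  have := integrable_fin_num measurableT iE1; have := integrable_fin_num measurableT iE2.
  have := integrable_fin_num measurableT iE3.
  case: (\int[mu]_w (fg f g s r w * I k w)%:E)%E => [x||]//; case: (\int[mu]_w (Dfg f g s r h w)%:E)%E => [y||]//.
  case: (\int[mu]_w (fg f g s r w * J w)%:E)%E => [z||]// _ _ _.
  rewrite -!EFinB !abse_EFin !lee_fin => b1 b2.
  rewrite (_ : z - y = - (x - z) + (x - y)); last by ring.
  by apply: (le_trans (ler_normD _ _)); rewrite normrN mulrDl lerD.
move: key.
have := integrable_fin_num measurableT iE1; have := integrable_fin_num measurableT iE2.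
case: (\int[mu]_w (Dfg f g s r h w)%:E)%E => [y||]//.
case: (\int[mu]_w (fg f g s r w * J w)%:E)%E => [z||]// _ _ key.
congr EFin; apply/eqP; rewrite -subr_eq0 -normr_le0; apply/ler_addgt0Pr => e e0.
rewrite add0r.
(* With K = C + C' B the bound is 2 K delta; dividing [e] by 2 K + 1 keeps it below [e] and avoids a
   zero denominator. *)
have K0 : 0 < 2 * (C + C' * B) + 1 by rewrite ltr_wpDl// mulr_ge0// addr_ge0// mulr_ge0.
have d0 : 0 < e / (2 * (C + C' * B) + 1) by rewrite divr_gt0.
have := key _ d0; rewrite -EFinB abse_EFin lee_fin => /le_trans; apply; rewrite -subr_ge0.
have -> : e - (C + C' * B) * (e / (2 * (C + C' * B) + 1) + e / (2 * (C + C' * B) + 1)) =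
   e / (2 * (C + C' * B) + 1) by field; rewrite gt_eqF.
exact: ltW.
Qed.

End WienerIBP.

(** * Averaging over the subordinator *)

Section ExtendedFubini.
Context (d1 d2 : measure_display) (O1 : measurableType d1) (O2 : measurableType d2).
Context (R : realType) (P1 : probability O1 R) (P2 : probability O2 R).

(** The four bounds survive [+oo - +oo = -oo], so positive and negative parts of a difference can be
    compared with its terms without excluding the points where both are infinite. *)
Lemma maxe_sub_bounds (x y : \bar R) : 0 <= x -> 0 <= y ->
  [/\ maxe (x - y) 0 <= x, maxe (- (x - y)) 0 <= y,
      x <= y + maxe (x - y) 0 & y <= x + maxe (- (x - y)) 0].
Proof.
move: x y => [x||] [y||]//; rewrite ?lee_fin => x0 y0.
- rewrite -EFinB -EFinN -!EFin_max -!EFinD !lee_fin.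
  by case: (leP (x - y)%R 0%R) => H; case: (leP (- (x - y))%R 0%R) => H'; split; lra.
- split; rewrite /= ?maxNye ?maxye ?addye ?addey ?leey// lee_fin.
- split; rewrite /= ?maxNye ?maxye ?addye ?addey ?leey// lee_fin.
- split; rewrite /= ?maxNye ?maxye ?addye ?addey ?leey//.
Qed.

(* Only one of the two integrals has to be finite. *)
Lemma integralB_lty (disp : measure_display) (O : measurableType disp)
    (nu : {measure set O -> \bar R}) (A B : O -> \bar R) :
  measurable_fun setT A -> measurable_fun setT B ->
  (forall o, 0 <= A o) -> (forall o, 0 <= B o) ->
  \int[nu]_o A o < +oo \/ \int[nu]_o B o < +oo ->
  \int[nu]_o (A o - B o) = \int[nu]_o A o - \int[nu]_o B o.
Proof.
move=> mA mB A0 B0 AB.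
have mAB : measurable_fun setT (fun o => A o - B o) by exact: emeasurable_funB.
have integrable_of C : measurable_fun setT C -> (forall o, 0 <= C o) ->
    \int[nu]_o C o < +oo -> nu.-integrable setT C.
  move=> mC C0 Coo; apply/integrableP; split => //.
  by rewrite (eq_integral C)// => o _; rewrite gee0_abs.
have posle : \int[nu]_o (fun o => A o - B o)^\+ o <= \int[nu]_o A o.
  apply: ge0_le_integral => //; first exact: measurable_funepos.
  by move=> o _; rewrite funeposE; have [] := maxe_sub_bounds (A0 o) (B0 o).
have negle : \int[nu]_o (fun o => A o - B o)^\- o <= \int[nu]_o B o.
  apply: ge0_le_integral => //; first exact: measurable_funeneg.
  by move=> o _; rewrite funenegE; have [] := maxe_sub_bounds (A0 o) (B0 o).
have leA : \int[nu]_o A o <= \int[nu]_o B o + \int[nu]_o (fun o => A o - B o)^\+ o.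
  rewrite -ge0_integralD//; last exact: measurable_funepos.
  apply: ge0_le_integral => //; first exact/emeasurable_funD/measurable_funepos.
  by move=> o _; rewrite funeposE; have [] := maxe_sub_bounds (A0 o) (B0 o).
have leB : \int[nu]_o B o <= \int[nu]_o A o + \int[nu]_o (fun o => A o - B o)^\- o.
  rewrite -ge0_integralD//; last exact: measurable_funeneg.
  apply: ge0_le_integral => //; first exact/emeasurable_funD/measurable_funeneg.
  by move=> o _; rewrite funenegE; have [] := maxe_sub_bounds (A0 o) (B0 o).
(* If exactly one integral is infinite, [leA] or [leB] forces the corresponding part of the
   difference to have infinite integral, while [negle] or [posle] keeps the other part finite; both
   sides are then the same infinity. *)
have [Aoo|Aoo] := ltP (\int[nu]_o A o) +oo; have [Boo|Boo] := ltP (\int[nu]_o B o) +oo.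
- by apply: integralB => //; exact: integrable_of.
- rewrite integralE; have : 0 <= \int[nu]_o (fun o => A o - B o)^\+ o by exact: integral_ge0.
  move: posle leB Aoo Boo; have : 0 <= \int[nu]_o A o by exact: integral_ge0.
  case: (\int[nu]_o A o) => [x||]// _; case: (\int[nu]_o B o) => [y||]//.
  case: (\int[nu]_o _^\+ o) => [p||]//; case: (\int[nu]_o _^\- o) => [q||]//.
- rewrite integralE; have : 0 <= \int[nu]_o (fun o => A o - B o)^\- o by exact: integral_ge0.
  move: negle leA Aoo Boo; have : 0 <= \int[nu]_o B o by exact: integral_ge0.
  case: (\int[nu]_o A o) => [x||]//; case: (\int[nu]_o B o) => [y||]// _.
  case: (\int[nu]_o _^\+ o) => [p||]//; case: (\int[nu]_o _^\- o) => [q||]//.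
- by case: AB => [/(le_lt_trans Aoo)|/(le_lt_trans Boo)]; rewrite ltxx.
Qed.

(** An inner integral is by definition the difference of its positive and negative parts, with a
    conventional value where both are infinite. [integralB_lty] tolerates these values, so
    finiteness of one of the two double integrals is enough. *)
Lemma has_expectation_fubini (K : O1 * O2 -> R) : measurable_fun setT K ->
  has_expectation (P1 \x P2) K ->
  \int[P1 \x P2]_z (K z)%:E = \int[P2]_y \int[P1]_x (K (x, y))%:E.
Proof.
move=> mK.
have mE : measurable_fun setT (EFin \o K) by exact/measurable_EFinP.
have mp := measurable_funepos mE; have mn := measurable_funeneg mE.
have pE : (EFin \o K)^\+ = (fun z => (Num.max (K z) 0%R)%:E).
  by apply/funext => z; rewrite funeposE /= EFin_max.
have nE : (EFin \o K)^\- = (fun z => (Num.max (- K z) 0%R)%:E).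
  by apply/funext => z; rewrite funenegE /= EFin_max.
rewrite /has_expectation -pE -nE => hK.
rewrite [LHS]integralE.
rewrite -/(EFin \o K) in hK *.
rewrite fubini_tonelli2// in hK *.
rewrite fubini_tonelli2// in hK *.
rewrite -integralB_lty//.
- apply: eq_integral => y _; rewrite [RHS]integralE /fubini_G; congr (_ - _);
    by apply: eq_integral => x _; rewrite ?funeposE ?funenegE.
- exact: measurable_fun_fubini_tonelli_G.
- exact: measurable_fun_fubini_tonelli_G.
- by move=> y; exact: integral_ge0.
- by move=> y; exact: integral_ge0.
Qed.

Lemma measurable_fubini_inner (K : O1 * O2 -> R) : measurable_fun setT K ->
  measurable_fun setT (fun y => \int[P1]_x (K (x, y))%:E).
Proof.
move=> mK; have mE : measurable_fun setT (EFin \o K) by exact/measurable_EFinP.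
have -> : (fun y => \int[P1]_x (K (x, y))%:E) =
    (fun y => fubini_G P1 (EFin \o K)^\+ y - fubini_G P1 (EFin \o K)^\- y).
  apply/funext => y; rewrite integralE /fubini_G; congr (_ - _);
    by apply: eq_integral => x _; rewrite ?funeposE ?funenegE.
apply: emeasurable_funB; apply: measurable_fun_fubini_tonelli_G => //.
- exact: measurable_funepos.
- exact: measurable_funeneg.
Qed.

Lemma has_expectation_ae_eq (K L : O1 * O2 -> R) :
  measurable_fun setT K -> measurable_fun setT L ->
  has_expectation (P1 \x P2) K -> has_expectation (P1 \x P2) L ->
  {ae P2, forall y, \int[P1]_x (K (x, y))%:E = \int[P1]_x (L (x, y))%:E} ->
  \int[P1 \x P2]_z (K z)%:E = \int[P1 \x P2]_z (L z)%:E.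
Proof.
move=> mK mL hK hL KL; rewrite !has_expectation_fubini//.
apply: ae_eq_integral => //; try exact: measurable_fubini_inner.
by apply: (@filterS _ _ (ae_filter_ringOfSetsType P2)) KL => y E _.
Qed.

End ExtendedFubini.

(** * Almost sure finiteness of the energy *)

Section FiniteEnergy.
Context {R : realType} (d : nat) (T M : \bar R) (lambda : probability (sspace T) R).
Local Open Scope ring_scope.
Notation leb := (@lebesgue_measure R).

Lemma measurable_open_time_set (A : \bar R) : measurable (open_time_set A : set (measurableTypeR R)).
Proof.
rewrite (_ : open_time_set A = match A with r%:E => `]0%R, r[%classic | +oo%E => `]0%R, +oo[%classic | -oo%E => set0 end).
  by case: A => [r||].
case: A => [r||]; apply/seteqP; split => t; rewrite /open_time_set /= ?in_itv/= ?lte_fin ?andbT//.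
- by move=> [-> ->].
- by move=> /andP.
- by case.
- by move=> t0; rewrite ltry.
- by case.
Qed.

Hypothesis hM : M = ess_sup lambda (@terminal R T).

(** By Tonelli's theorem, the integral of |h'(t)|^2 P(S_T >= t) is the expectation of the energy up
    to S_T, and a nonnegative variable with finite expectation is almost surely finite. *)
Lemma in_H_finite_energy (h : wpath R d M) : in_H lambda 1%R h ->
  (\forall l \ae lambda,
      \int[lebesgue_measure]_(t in open_time_set (terminal l))
        (sqnormv (derive1 h t))%:E < +oo)%E.
Proof.
move=> [hAC H].
have [f [mf _ [N [mN N0 NE]]]] := wpath_density hAC.
have fE t : open_time_set M t -> ~ N t -> derive1 h t = f t.
  by move=> Mt Nt; apply: contrapT => ne; apply: Nt; apply: NE => /= /(_ Mt).
have mD := measurable_open_time_set M.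
have msq : measurable_fun setT (fun t => sqnormv (f t)).
  rewrite /sqnormv /dotv; apply: measurable_sum => i.
  exact: measurable_funM.
pose L : set (measurableTypeR R * sspace T) := [set z | ((z.1 : R)%:E <= terminal (z.2 : spath T))%E].
have mL : measurable L.
  have -> : L = [set z | (0 <= terminal (z.2 : spath T) - (z.1 : R)%:E)%E].
    apply/funext => -[t l]; rewrite /L /mkset /=.
    by rewrite (@sube_ge0 R t%:E (terminal (l : spath T))).
  rewrite -[X in measurable X]setTI; apply: emeasurable_fun_c_infty => //.
  apply: emeasurable_funB; last by apply/measurable_EFinP; exact: measurable_fst.
  exact: (measurableT_comp (@measurable_terminal R T) measurable_snd).
(* Tonelli's theorem is applied to a jointly measurable integrand: [f] replaces [derive1 h], and is
   cut off outside (0, M), where the two are not compared. *)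
pose K (z : measurableTypeR R * sspace T) : \bar R :=
  (sqnormv (f z.1) * \1_(open_time_set M) z.1 * \1_L z)%:E.
have mK : measurable_fun setT K.
  apply/measurable_EFinP; apply: measurable_funM; last exact: measurable_indic.
  apply: measurable_funM; first exact: (measurableT_comp msq measurable_fst).
  exact: (measurableT_comp (measurable_indic mD) measurable_fst).
have K0 z : (0 <= K z)%E by rewrite lee_fin !mulr_ge0// sqnormv_ge0.
have Koo : (\int[lambda]_l \int[leb]_t K (t, l) < +oo)%E.
  rewrite -(fubini_tonelli K)//; apply: le_lt_trans H.
  rewrite [leRHS]integral_mkcond.
  apply: (@ge0_le_integral_ae _ _ _ leb _ N) => //.
  - by move=> t _; apply: integral_ge0.
  - move=> t; rewrite patchE; case: ifP => // _.
    by rewrite lee_fin mulr_ge0 ?sqnormv_ge0// powR_ge0.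
  move=> t _ Nt; rewrite patchE /K/=.
  case: ifPn => [|tM]; last first.
    rewrite integral0_eq// => l _; rewrite indicE (negbTE tM) mulr0 mul0r//.
  rewrite inE => tM.
  under eq_integral do rewrite EFinM.
  rewrite ge0_integralZl//; last 2 first.
  - apply/measurable_EFinP.
    exact: (measurableT_comp (measurable_indic mL) (pair1_measurable t)).
  - by rewrite lee_fin mulr_ge0// sqnormv_ge0.
  pose S : set (sspace T) := [set l | (t%:E <= terminal (l : spath T))%E].
  have mS : measurable S.
    rewrite (_ : S = xsection L t); first exact: measurable_xsection.
    by apply/seteqP; split => l /=; rewrite /xsection/= in_setE.
  rewrite (eq_integral (fun l => (\1_S l)%:E))//.
  rewrite integral_indic// setIT (fE _ tM Nt) indicE mem_set// mulr1 EFinM.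
  rewrite lee_wpmul2l ?lee_fin ?sqnormv_ge0//.
  rewrite powRr1 ?fine_ge0//= ?measure_ge0//.
  by rewrite -/S fineK// fin_num_measure.
have : {ae lambda, forall l, (\int[leb]_t K (t, l) < +oo)%E}.
  have mG := measurable_fun_fubini_tonelli_G K mK K0.
  have iG : lambda.-integrable setT (fubini_G leb K).
    apply/integrableP; split; first exact: mG.
    apply: le_lt_trans Koo; rewrite le_eqVlt; apply/orP; left; apply/eqP.
    by apply: eq_integral => l _; rewrite gee0_abs// integral_ge0.
  have := integrable_ae measurableT iG.
  apply: (@filterS _ _ (ae_filter_ringOfSetsType lambda)) => l /(_ I).
  by rewrite ge0_fin_numE// integral_ge0.
(* As l_T <= M for almost every [l], the interval (0, l_T) lies in (0, M), where [f] agrees with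
   [derive1 h] off the null set. *)
have tlM := @ess_sup_ge _ _ _ lambda (@terminal R T : sspace T -> \bar R).
move: tlM; apply: filterS2 => l lM Kl; apply: le_lt_trans Kl.
apply: (@ge0_le_integral_ae _ _ _ leb _ N) => //.
- by move=> t _; rewrite lee_fin sqnormv_ge0.
move=> t tl Nt; rewrite lee_fin /=.
have tM : open_time_set M t.
  by case: tl => t0 tl; split => //; apply: (lt_le_trans tl); rewrite hM.
rewrite (fE t tM Nt) !indicE !mem_set ?mulr1//.
by rewrite /L/= ltW//; case: tl.
Qed.

End FiniteEnergy.

(** * Joint measurability in the path and the subordinator *)

Section JointMeasurability.
Context {R : realType} (d : nat) (T M : \bar R).
Local Open Scope ring_scope.

Lemma measurable_grad (disp : measure_display) (O : measurableType disp) n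
    (f : 'M[R]_(n, d) -> R) (B A : O -> 'M[R]_(n, d)) : Cb 1 f ->
  (forall i j, measurable_fun setT (fun o => B o i j)) ->
  (forall i j, measurable_fun setT (fun o => A o i j)) ->
  measurable_fun setT (fun o => grad f (B o) (A o)).
Proof.
move=> [_ _ Hf] mB mA; apply: measurable_sum => p.
have [_ [cdf _ _]] := Hf p.1 p.2.
apply: measurable_funM; first exact: mB.
exact: (@measurable_continuous_mx _ O R n d _ A cdf).
Qed.

Lemma measurable_evalmx_comp n (t : 'I_n -> R) (i : 'I_n) (j : 'I_d) :
  measurable_fun setT (fun z : wspace R d M * sspace T =>
    evalmx ((z.2 : spath T) \o t) (z.1 : wpath R d M) i j).
Proof.
under eq_fun do rewrite mxE.
apply: (@measurable_weval R d M _ (wspace R d M * sspace T)%type fst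
  (fun z => (z.2 : spath T) (t i)) j) => //.
exact: (measurableT_comp (@measurable_scoord R T (t i)) measurable_snd).
Qed.

Lemma measurable_evalmx_shift n (t : 'I_n -> R) (h : wpath R d M) (i : 'I_n) (j : 'I_d) :
  measurable_fun setT (fun z : wspace R d M * sspace T =>
    evalmx ((z.2 : spath T) \o t) h i j).
Proof.
under eq_fun do rewrite mxE.
apply: (@measurable_weval R d M _ (wspace R d M * sspace T)%type (fun=> h)
  (fun z => (z.2 : spath T) (t i)) j) => //.
exact: (measurableT_comp (@measurable_scoord R T (t i)) measurable_snd).
Qed.

End JointMeasurability.

Section PathwiseIBP.
Context {R : realType} (d : nat) (M : \bar R) (mu : probability (wspace R d M) R).
Local Open Scope ring_scope.
Variables (n m : nat) (f : 'M[R]_(n, d) -> R) (g : 'M[R]_(m, d) -> R).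
Hypotheses (Cf : Cb 1 f) (Cg : Cb 1 g).
Variables (s : 'I_n -> R) (r : 'I_m -> R).

(** By the product rule, [X] and [Y] arise from the two sides of [ibp] by subtracting the same
    bounded function [Z], the product of [f] and the derivative of [g]. *)
Lemma ibp_adjoint (h : R -> 'rV[R]_d) (J : wspace R d M -> R)
    (X Y : wspace R d M -> R) :
  (forall w, X w = g (evalmx r (w : wpath R d M)) *
                   grad f (evalmx s h) (evalmx s (w : wpath R d M))) ->
  (forall w, Y w = f (evalmx s (w : wpath R d M)) *
      (- grad g (evalmx r h) (evalmx r (w : wpath R d M)) +
       g (evalmx r (w : wpath R d M)) * J w)) ->
  ibp mu f g s r J h ->
  [/\ mu.-integrable setT (fun w => (X w)%:E), mu.-integrable setT (fun w => (Y w)%:E) &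
      (\int[mu]_w (X w)%:E = \int[mu]_w (Y w)%:E)%E].
Proof.
move=> XE YE [iJ E].
pose Z (w : wspace R d M) := f (evalmx s (w : wpath R d M)) *
  grad g (evalmx r h) (evalmx r (w : wpath R d M)).
have iZ : mu.-integrable setT (fun w => (Z w)%:E).
  have [C1 C10 fC] := Cb_bounded Cf; have [D D0 dgC] := bounded_grad Cg.
  have [cf _ _] := Cf.
  apply: (@probability_bounded_integrable _ (wspace R d M) _ mu Z
      (C1 * (D * \sum_(p : 'I_m * 'I_d) `|evalmx r h p.1 p.2|))).
    apply: measurable_funM; apply: measurable_path_fun => //; exact: continuous_grad.
  by move=> w; rewrite normrM ler_pM.
have iJ' := integrable_fgM Cf Cg s r iJ.
have iD := integrable_Dfg mu Cf Cg s r h.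
have XZ : (fun w => (X w)%:E) = (fun w => (Dfg f g s r h w)%:E - (Z w)%:E)%E.
  by apply/funext => w; rewrite XE -EFinB /Dfg /Z; congr EFin; ring.
have YZ : (fun w => (Y w)%:E) = (fun w => (fg f g s r w * J w)%:E - (Z w)%:E)%E.
  by apply/funext => w; rewrite YE -EFinB /fg /Z; congr EFin; ring.
rewrite XZ YZ; split; [exact: integrableB|exact: integrableB|].
by rewrite !integralB// E.
Qed.

End PathwiseIBP.

Theorem theorem3p1 (R : realType) (d : nat) (hd : (0 < d)%N)
  (T : \bar R) (hT : 0 < T)
  (lambda : probability (sspace T) R) (b : R)
  (nu : {measure set (measurableTypeR R) -> \bar R})
  (hS : subordinator_law lambda b nu) (hS0 : nontrivial_law lambda)
  (M : \bar R) (hM : M = ess_sup lambda (@terminal R T))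
  (mu : probability (wspace R d M) R) (hW : brownian_law mu)
  (h : wpath R d M) (hAC : abs_continuous M h) :
  let finite_energy :=
    \forall l \ae lambda,
      \int[lebesgue_measure]_(t in open_time_set (terminal l))
        (sqnormv (derive1 h t))%:E < +oo in
  (in_H lambda 1%R h -> finite_energy) /\
  (finite_energy ->
   forall F G : (R -> 'rV[R]_d) -> R,
   FCb_infty T M F -> FCb_infty T M G ->
   forall J : wspace R d M * sspace T -> R,
   is_stochastic_integral mu lambda h J ->
   let X := fun z : wspace R d M * sspace T =>
     (on_paths G z * Dh h F z)%R in
   let Y := fun z : wspace R d M * sspace T =>
     (on_paths F z * Dh_adj h J G z)%R in
   (has_expectation (mu \x lambda) X -> has_expectation (mu \x lambda) Y ->
    'E_(mu \x lambda)[X] = 'E_(mu \x lambda)[Y]) /\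
   (\forall l \ae lambda,
      [/\ mu.-integrable setT (fun w => (X (w, l))%:E),
          mu.-integrable setT (fun w => (Y (w, l))%:E) &
          'E_mu[fun w => X (w, l)] = 'E_mu[fun w => Y (w, l)]])).
Proof.
split; first exact: in_H_finite_energy.
move=> _ F G [n [f [t [Cf tT _ HF]]]] [m [g [r [Cg rT _ HG]]]] J [mJ wJ] X Y.
have {}Cf := Cf 1%N; have {}Cg := Cg 1%N.
have XE z : X z = (g (evalmx ((z.2 : spath T) \o r) (z.1 : wpath R d M)) *
    grad f (evalmx ((z.2 : spath T) \o t) h) (evalmx ((z.2 : spath T) \o t) (z.1 : wpath R d M)))%R.
  by case: z => w l; rewrite /X (on_paths_evalmx _ _ HG) (Dh_grad h w l Cf HF).
have YE z : Y z = (f (evalmx ((z.2 : spath T) \o t) (z.1 : wpath R d M)) *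
    (- grad g (evalmx ((z.2 : spath T) \o r) h) (evalmx ((z.2 : spath T) \o r) (z.1 : wpath R d M)) +
     g (evalmx ((z.2 : spath T) \o r) (z.1 : wpath R d M)) * J z))%R.
  case: z => w l; rewrite /Y /Dh_adj (on_paths_evalmx _ _ HF) (on_paths_evalmx _ _ HG).
  by rewrite (Dh_grad h w l Cg HG).
have main : {ae lambda, forall l,
    [/\ mu.-integrable setT (fun w => (X (w, l))%:E),
        mu.-integrable setT (fun w => (Y (w, l))%:E) &
        \int[mu]_w (X (w, l))%:E = \int[mu]_w (Y (w, l))%:E]}.
  (* As M is the essential supremum of S_T, almost every [l] satisfies l_T <= M, so all times
     l_(t_i) and l_(r_j) lie in [0, l_T], within [0, M]. *)
  have tlM := @ess_sup_ge _ _ _ lambda (@terminal R T : sspace T -> \bar R).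
  apply: (@filterS2 _ _ (ae_filter_ringOfSetsType lambda)) tlM wJ => l lM Jl.
  have time k (s : 'I_k -> R) : (forall i, time_set T (s i)) ->
      forall i, time_set (terminal (l : spath T)) (((l : spath T) \o s) i).
    move=> sT i; split; last exact: le_terminal.
    have [s0 _] := sT i.
    by rewrite -(lval_start (l : spath T) (lexx 0%R)); exact: lval_nondecreasing.
  have lM' : terminal (l : spath T) <= M by rewrite hM.
  have := wiener_ibp hW Cf Cg (time _ _ tT) (time _ _ rT) lM' hAC Jl.
  by apply: ibp_adjoint.
split; last first.
  apply: (@filterS _ _ (ae_filter_ringOfSetsType lambda)) main => l [iX iY E].
  by split => //; rewrite unlock.
have [cf _ _] := Cf; have [cg _ _] := Cg.
(* Joint measurability is read off the gradient formulas [XE] and [YE], which replace the limits in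
   the definition of [Dh]. *)
move=> hX hY; rewrite unlock; apply: has_expectation_ae_eq => //.
- rewrite (funext XE); apply: measurable_funM.
    by apply: (measurable_continuous_mx cg) => i j; exact: measurable_evalmx_comp.
  apply: measurable_grad => // i j; first exact: measurable_evalmx_shift.
  exact: measurable_evalmx_comp.
- rewrite (funext YE); apply: measurable_funM.
    by apply: (measurable_continuous_mx cf) => i j; exact: measurable_evalmx_comp.
  apply: measurable_funD.
    apply: measurableT_comp => //.
    apply: measurable_grad => // i j; first exact: measurable_evalmx_shift.
    exact: measurable_evalmx_comp.
  apply: measurable_funM => //.
  by apply: (measurable_continuous_mx cg) => i j; exact: measurable_evalmx_comp.
- by apply: (@filterS _ _ (ae_filter_ringOfSetsType lambda)) main => l [].
Qed.
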